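(* Let $\mathcal{H}$ be a pure contractive $\mathcal{A}_d$-module and let $$\cdots \xrightarrow{\Phi_2} \mathcal{F}_1 \xrightarrow{\Phi_1} \mathcal{F}_0 \xrightarrow{\Phi_0} \mathcal{H} \to 0$$ be a free resolution of $\mathcal{H}$, where $\mathcal{F}_i = H_d^2\otimes \mathcal{C}_i$ for Hilbert spaces $\mathcal{C}_i$. Localize at $0$ to obtain the complex $$\cdots \xrightarrow{\Phi_3(0)} \mathcal{C}_2 \xrightarrow{\Phi_2(0)} \mathcal{C}_1 \xrightarrow{\Phi_1(0)} \mathcal{C}_0 .$$ Let $$\cdots \xrightarrow{\partial_3} E_2 \xrightarrow{\partial_2} E_1 \xrightarrow{\partial_1} E_0 \to 0$$ be the Koszul complex of $\mathcal{H}$. Then for all $k\ge 1$, $$\frac{\ker \partial_k}{\operatorname{im} \partial_{k+1}} \cong \frac{\ker \Phi_k(0)}{\operatorname{im}\Phi_{k+1}(0)}$$ (isomorphism of complex vector spaces).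
   Context: $\mathcal{A}_d=\mathbb{C}[z_1,\dots,z_d]$, and $B_d$ is the open unit ball of $\mathbb{C}^d$. A contractive $\mathcal{A}_d$-module is a Hilbert space $\mathcal{H}$ that is an $\mathcal{A}_d$-module with $\|\sum_{k=1}^d z_k\xi_k\|^2\le \sum_{k=1}^d\|\xi_k\|^2$ for all $\xi_1,\dots,\xi_d\in\mathcal{H}$. If $\mathcal{K}$ is a closed submodule, the quotient $\mathcal{H}/\mathcal{K}$ is identified with $\mathcal{H}\ominus\mathcal{K}$, with polynomials acting by compression to $\mathcal{H}\ominus\mathcal{K}$; it is again a contractive module. $H_d^2$ is the Hilbert space of holomorphic functions on $B_d$ with reproducing kernel $k(z,\lambda)=\frac{1}{1-\langle z,\lambda\rangle}$; $\mathcal{A}_d$ acts on it by multiplication, making it a contractive $\mathcal{A}_d$-module. A free module is a module $H_d^2\otimes\mathcal{C}$ with $\mathcal{C}$ a Hilbert space of arbitrary dimension ($\mathcal{A}_d$ acting on the first factor). A contractive $\mathcal{A}_d$-module is pure if it is unitarily isomorphic (as a module) to a quotient of a free module by a closed submodule. An element $\xi\in H_d^2\otimes\mathcal{C}$ is viewed as a $\mathcal{C}$-valued function on $B_d$ via $\langle\xi(\lambda),\eta\rangle_{\mathcal{C}}=\langle \xi,k_\lambda\otimes\eta\rangle$ for $\eta\in\mathcal{C}$, where $k_\lambda=k(\cdot,\lambda)$. For a (bounded) module homomorphism $\Phi:H_d^2\otimes\mathcal{D}\to H_d^2\otimes\mathcal{C}$ and $\lambda\in B_d$, $\Phi(\lambda):\mathcal{D}\to\mathcal{C}$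 is the bounded operator $\Phi(\lambda)\eta=(\Phi(1\otimes\eta))(\lambda)$. A free resolution of $\mathcal{H}$ is an exact sequence $\cdots\xrightarrow{\Phi_2}\mathcal{F}_1\xrightarrow{\Phi_1}\mathcal{F}_0\xrightarrow{\Phi_0}\mathcal{H}\to0$ in which each $\mathcal{F}_i=H_d^2\otimes\mathcal{C}_i$ is free and each $\Phi_i$ is a partially isometric module homomorphism. The Koszul complex of $\mathcal{H}$: $E_k=\mathcal{H}\otimes\bigwedge^k\mathbb{C}^d$ (zero for $k<0$ or $k>d$), and, for a fixed orthonormal basis $e_1,\dots,e_d$ of $\mathbb{C}^d$, $\partial_k:E_k\to E_{k-1}$ is given by $\partial_k(\xi\otimes e_{i_1}\wedge\cdots\wedge e_{i_k})=\sum_{j=1}^k(-1)^{j+1}z_{i_j}\xi\otimes e_{i_1}\wedge\cdots\wedge\widehat{e_{i_j}}\wedge\cdots\wedge e_{i_k}$. *)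

(* Defs.v *)
From HB Require Import structures.
From mathcomp Require Import all_boot all_order all_algebra.
From mathcomp Require Import all_classical all_reals all_analysis.
From mathcomp Require Import complex.
From mathcomp Require mpoly.
(* The notations of mpoly clash with those of all_analysis. *)
Export(canonicals,coercions) mpoly.

Set Implicit Arguments.
Unset Strict Implicit.
Unset Printing Implicit Defensive.

Import Order.TTheory GRing.Theory Num.Theory.
Import numFieldNormedType.Exports.

Local Open Scope classical_set_scope.
Local Open Scope complex_scope.
Local Open Scope ring_scope.

Section QuotientSpace.
Variables (K : nzRingType) (V : lmodType K) (I : submodClosed V).

Definition sub_pred : {pred V} := [pred x | x \in I].

Fact sub_zmod_closed : zmod_closed sub_pred.
Proof.
split=> [|x y]; rewrite !inE ?rpred0 // => hx hy.
by rewrite rpredD // -scaleN1r rpredZ.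
Qed.
HB.instance Definition _ := GRing.isZmodClosed.Build V sub_pred sub_zmod_closed.

Definition quot_space : Type := Quotient.quot sub_pred.
HB.instance Definition _ := GRing.Zmodule.on quot_space.

Definition quot_proj (x : V) : quot_space := \pi_(Quotient.quot sub_pred)%qT x.

Definition quot_scale (a : K) (q : quot_space) : quot_space :=
  quot_proj (a *: repr (q : Quotient.quot sub_pred)).

Lemma quot_projP (x y : V) : quot_proj x = quot_proj y <-> x - y \in I.
Proof.
by split=> [/eqP|h]; [|apply/eqP]; rewrite /quot_proj -Quotient.idealrBE.
Qed.

Lemma quot_proj_repr (q : quot_space) :
  quot_proj (repr (q : Quotient.quot sub_pred)) = q.
Proof. by rewrite /quot_proj reprK. Qed.

Lemma quot_projZ (a : K) (x : V) : quot_scale a (quot_proj x) = quot_proj (a *: x).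
Proof.
apply/quot_projP; rewrite -scalerBr rpredZ //.
by apply/quot_projP; rewrite quot_proj_repr.
Qed.

Lemma quot_projD (x y : V) : quot_proj (x + y) = quot_proj x + quot_proj y.
Proof. exact: (raddfD \pi_(Quotient.quot sub_pred)%qT). Qed.

Fact quot_scaleA a b q : quot_scale a (quot_scale b q) = quot_scale (a * b) q.
Proof. by rewrite -(quot_proj_repr q) !quot_projZ scalerA. Qed.
Fact quot_scale1 : left_id 1 quot_scale.
Proof. by move=> q; rewrite -(quot_proj_repr q) quot_projZ scale1r. Qed.
Fact quot_scaleDr : right_distributive quot_scale +%R.
Proof.
move=> a q r; rewrite -(quot_proj_repr q) -(quot_proj_repr r).
by rewrite -quot_projD !quot_projZ scalerDr quot_projD.
Qed.
Fact quot_scaleDl q : {morph quot_scale^~ q : a b / a + b}.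
Proof.
move=> a b /=; rewrite -(quot_proj_repr q) !quot_projZ.
by rewrite scalerDl quot_projD.
Qed.

HB.instance Definition _ := GRing.Zmodule_isLmodule.Build K quot_space
  quot_scaleA quot_scale1 quot_scaleDr quot_scaleDl.

Fact quot_proj_is_linear : linear quot_proj.
Proof. by move=> a x y; rewrite quot_projD -quot_projZ. Qed.
HB.instance Definition _ :=
  GRing.isLinear.Build K V quot_space *:%R quot_proj quot_proj_is_linear.

End QuotientSpace.

Section Homology.
Variables (K : nzRingType) (U V W : lmodType K).
Variables (f : {linear U -> V}) (g : {linear V -> W}).

Definition ker_pred : {pred V} := [pred x | g x == 0].

Fact ker_submod_closed : submod_closed ker_pred.
Proof.
split=> [|a x y]; rewrite !inE ?linear0 // => /eqP gx /eqP gy.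
by rewrite linearP gx gy scaler0 addr0.
Qed.
HB.instance Definition _ :=
  GRing.isSubmodClosed.Build K V ker_pred ker_submod_closed.

Record ker_space := KerSpace { ker_val :> V; _ : ker_val \in ker_pred }.
HB.instance Definition _ := [isSub for ker_val].
HB.instance Definition _ := [Choice of ker_space by <:].
HB.instance Definition _ := [SubChoice_isSubLmodule of ker_space by <:].

Definition im_pred : {pred ker_space} :=
  [pred z | `[< exists u, f u = ker_val z >]].

Fact im_submod_closed : submod_closed im_pred.
Proof.
split=> [|a x y]; rewrite !inE.
  by exists 0; rewrite linear0.
move=> [u fu] [v fv]; exists (a *: u + v).
by rewrite linearP fu fv.
Qed.
HB.instance Definition _ :=
  GRing.isSubmodClosed.Build K ker_space im_pred im_submod_closed.

(** [ker g / (im f `&` ker g)], i.e. [ker g / im f] when [g \o f = 0]. *)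
Definition homology := quot_space im_pred.
HB.instance Definition _ := GRing.Lmodule.on homology.

End Homology.

HB.mixin Record isHilbert (R : realType) V & CompleteNormedModule R[i] V := {
  inner : V -> V -> R[i] ;
  innerDl : forall x y z : V, inner (x + y) z = inner x z + inner y z ;
  innerZl : forall (a : R[i]) (x z : V), inner (a *: x) z = a * inner x z ;
  innerC : forall x y : V, inner x y = (inner y x)^* ;
  normr_inner : forall x : V, `|x| ^+ 2 = inner x x
}.

#[short(type="hilbertType")]
HB.structure Definition Hilbert (R : realType) :=
  {V of CompleteNormedModule R[i] V & isHilbert R V}.

Notation "''[' u , v ]" := (inner u v) : ring_scope.

HB.mixin Record isPolyModule (R : realType) (d : nat) V & GRing.Lmodule R[i] V := {
  act : mpoly.mpoly d R[i] -> V -> V ;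
  actDr : forall p x y, act p (x + y) = act p x + act p y ;
  actDl : forall p q x, act (p + q) x = act p x + act q x ;
  actM : forall p q x, act (p * q) x = act p (act q x) ;
  actC : forall c x, act (mpoly.mpolyC d c) x = c *: x
}.

#[short(type="hilbertModType")]
HB.structure Definition HilbertMod (R : realType) (d : nat) :=
  {V of Hilbert R V & isPolyModule R d V}.

Definition coordX (R : realType) (d : nat) (k : 'I_d) : mpoly.mpoly d R[i] :=
  mpoly.mpolyX R[i] (mpoly.mnm1 k).

Section HilbertTheory.
Variable (R : realType).
Implicit Types (H : hilbertType R).

Lemma innerBl H (x y z : H) : '[x - y, z] = '[x, z] - '[y, z].
Proof. by rewrite innerDl -scaleN1r innerZl mulN1r. Qed.
Lemma inner0l H (z : H) : '[0, z] = 0.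
Proof. by rewrite -(scale0r (0 : H)) innerZl mul0r. Qed.
Lemma innerBr H (x y z : H) : '[x, y - z] = '[x, y] - '[x, z].
Proof. by rewrite innerC innerBl rmorphB /= -!innerC. Qed.
Lemma innerZr H a (x z : H) : '[x, a *: z] = a^* * '[x, z].
Proof. by rewrite innerC innerZl rmorphM /= -innerC. Qed.
Lemma inner_ge0 H (x : H) : 0 <= '[x, x].
Proof. by rewrite -normr_inner exprn_ge0. Qed.

Lemma cauchy_schwarz H (x y : H) : `|'[x, y]| <= `|x| * `|y|.
Proof.
have [->|y0] := eqVneq y 0.
  by rewrite normr0 mulr0 -(subrr (0 : H)) innerBr subrr normr0.
rewrite -ler_sqr ?nnegrE ?mulr_ge0// exprMn !normr_inner.
have yy : '[y, y] != 0 by rewrite -normr_inner expf_neq0 // normr_eq0.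
set a := '[x, y] / '[y, y].
have := inner_ge0 (x - a *: y).
rewrite innerBl !innerBr !innerZl !innerZr mulrA -mulrA.
rewrite (innerC y x) (_ : a * (a^* * '[y, y]) = a * '[x, y]^*); last first.
  by rewrite /a rmorphM fmorphV /= -(innerC y y) divfK.
rewrite subrr subr0 subr_ge0.
rewrite /a rmorphM fmorphV /= -(innerC y y) mulrAC mulrC -normCKC => h.
have yy_gt0 : 0 < '[y, y] by rewrite lt0r yy inner_ge0.
by rewrite -ler_pdivrMr // mulrC.
Qed.

Lemma inner_inj H (x y : H) : (forall z, '[x, z] = '[y, z]) -> x = y.
Proof.
move=> h; apply/eqP; rewrite -subr_eq0 -normr_eq0 -sqrf_eq0 normr_inner.
by rewrite innerBl h subrr.
Qed.

End HilbertTheory.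

Section ActTheory.
Variables (R : realType) (d : nat) (H : hilbertModType R d).

Fact act_is_linear (p : mpoly.mpoly d R[i]) : linear (act p : H -> H).
Proof. by move=> a x y; rewrite actDr -actC -actM mulrC actM actC. Qed.
HB.instance Definition _ (p : mpoly.mpoly d R[i]) :=
  GRing.isLinear.Build R[i] H H *:%R (act p) (act_is_linear p).

Definition contractive : Prop := forall xi : 'I_d -> H,
  `|\sum_(k < d) act (coordX R k) (xi k)| ^+ 2 <= \sum_(k < d) `|xi k| ^+ 2.

Definition closed_submodule (K : set H) : Prop :=
  [/\ closed K, K 0, forall x y, K x -> K y -> K (x + y) &
      forall p x, K x -> K (act p x)].

End ActTheory.
Arguments contractive {R d} H.

Section Operators.
Variable (R : realType).

Definition orthocomp (H : hilbertType R) (K : set H) : set H :=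
  [set x | forall y, K y -> '[x, y] = 0].

Definition is_orthoproj (H : hilbertType R) (N : set H) (x y : H) : Prop :=
  N y /\ orthocomp N (x - y).

Definition bounded_op (H G : hilbertType R) (f : {linear H -> G}) : Prop :=
  exists M : R[i], forall x, `|f x| <= M * `|x|.

Definition partially_isometric (H G : hilbertType R) (f : {linear H -> G}) : Prop :=
  bounded_op f /\ (forall x, orthocomp [set y | f y = 0] x -> `|f x| = `|x|).

Definition module_hom (d : nat) (H G : hilbertModType R d)
    (f : {linear H -> G}) : Prop :=
  forall p x, f (act p x) = act p (f x).

End Operators.

Section DruryArveson.
Variables (R : realType) (d : nat).

Definition dotC (z w : 'rV[R[i]]_d) : R[i] := \sum_(k < d) z 0 k * (w 0 k)^*.

Definition unit_ball : set 'rV[R[i]]_d :=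
  [set z : 'rV[R[i]]_d | \sum_(k < d) `|z 0 k| ^+ 2 < 1].

(** A realization of the Hilbert space of holomorphic functions on the ball
    with reproducing kernel [1 / (1 - <z, w>)]: its vectors are the functions
    [da_eval f] restricted to the ball, which determine [f] by [da_ext], and
    polynomials act by multiplication.  Two realizations differ by the unitary
    module isomorphism that preserves the values of the functions.  Values
    outside the ball are irrelevant. *)
Record druryArveson := DruryArveson {
  da_space :> hilbertModType R d ;
  da_eval : da_space -> 'rV[R[i]]_d -> R[i] ;
  da_kernel : 'rV[R[i]]_d -> da_space ;
  da_holomorphic : forall f z, unit_ball z ->
    differentiable (da_eval f : 'rV[(R[i])^o]_d -> (R[i])^o)
      (z : 'rV[(R[i])^o]_d) ;
  da_ext : forall f g,
    (forall z, unit_ball z -> da_eval f z = da_eval g z) -> f = g ;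
  da_kernelE : forall w z, unit_ball w -> unit_ball z ->
    da_eval (da_kernel w) z = (1 - dotC z w)^-1 ;
  da_reproducing : forall f w, unit_ball w -> da_eval f w = '[f, da_kernel w] ;
  da_actE : forall p f z, unit_ball z ->
    da_eval (act p f) z = mpoly.meval (z 0) p * da_eval f z
}.

Lemma unit_ball0 : unit_ball 0.
Proof.
by rewrite /unit_ball /= big1 ?ltr01 // => k _; rewrite mxE normr0 expr0n.
Qed.

(** The constant function 1 is the kernel function at the origin. *)
Definition da_one (H2 : druryArveson) : H2 := da_kernel H2 0.

Lemma da_oneE (H2 : druryArveson) z : unit_ball z -> da_eval (da_one H2) z = 1.
Proof.
move=> zB; rewrite /da_one da_kernelE //; last exact: unit_ball0.
by rewrite /dotC big1 ?subr0 ?invr1 // => k _; rewrite mxE conjC0 mulr0.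
Qed.

(** The Hilbert space tensor product of [H2] and [C] (the completion of the
    algebraic one for the product inner product), with polynomials acting on
    the first factor. *)
Record freeModule (H2 : druryArveson) (C : hilbertType R) := FreeModule {
  free_space :> hilbertModType R d ;
  tens : {bilinear H2 -> C -> free_space} ;
  tens_inner : forall f g a b, '[tens f a, tens g b] = '[f, g] * '[a, b] ;
  tens_dense : dense [set x : free_space |
    exists s : seq (H2 * C), x = \sum_(t <- s) tens t.1 t.2] ;
  free_act_continuous : forall p, continuous (act p : free_space -> free_space) ;
  free_act : forall p f a, act p (tens f a) = tens (act p f) a
}.

End DruryArveson.
Arguments unit_ball {R d}.

Section Localization.
Variables (R : realType) (d : nat) (H2 : druryArveson R d).

Section Value.
Variables (C : hilbertType R) (F : freeModule H2 C).

(** The value at [z] of a vector [xi] of [H2 (x) C], seen as a [C]-valued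
    function: the vector [c] with [<c, eta> = <xi, k_z (x) eta>] for all
    [eta]. *)
Definition is_value (xi : F) (z : 'rV[R[i]]_d) (c : C) : Prop :=
  forall eta, '[c, eta] = '[xi, tens F (da_kernel H2 z) eta].

Definition value_at (xi : F) (z : 'rV[R[i]]_d) : C := xget 0 (is_value xi z).

Lemma norm_tens f a : `|tens F f a| = `|f| * `|a|.
Proof.
apply/eqP; rewrite -(@eqrXn2 _ 2) ?mulr_ge0 // exprMn !normr_inner.
by rewrite tens_inner.
Qed.

Lemma is_value_unique xi z c c' : is_value xi z c -> is_value xi z c' -> c = c'.
Proof. by move=> hc hc'; apply: inner_inj => eta; rewrite hc hc'. Qed.

Lemma is_valueP a xi xi' z c c' : is_value xi z c -> is_value xi' z c' ->
  is_value (a *: xi + xi') z (a *: c + c').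
Proof. by move=> hc hc' eta; rewrite !innerDl !innerZl hc hc'. Qed.

Lemma is_value0 z : is_value 0 z 0.
Proof. by move=> eta; rewrite !inner0l. Qed.

Lemma is_value_tens f a z : is_value (tens F f a) z ('[f, da_kernel H2 z] *: a).
Proof. by move=> eta; rewrite tens_inner innerZl. Qed.

Lemma norm_value xi z c : is_value xi z c -> `|c| <= `|da_kernel H2 z| * `|xi|.
Proof.
move=> hc; have [->|c0] := eqVneq c 0; first by rewrite normr0 mulr_ge0.
have c_gt0 : 0 < `|c| by rewrite normr_gt0.
rewrite -(ler_pM2r c_gt0) -expr2 normr_inner hc.
rewrite (le_trans (real_ler_norm _)) //.
  by rewrite -hc ger0_real ?inner_ge0.
rewrite (le_trans (cauchy_schwarz _ _)) // norm_tens.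
by rewrite mulrA (mulrC `|xi|).
Qed.

Lemma value_exists xi z : exists c, is_value xi z c.
Proof.
pose S := [set x : F | exists c, is_value x z c].
have span_S : [set x : F |
    exists s : seq (H2 * C), x = \sum_(t <- s) tens F t.1 t.2] `<=` S.
  move=> x [s ->]; elim: s => [|t s [c hc]].
    by rewrite big_nil; exists 0; apply: is_value0.
  rewrite big_cons; exists ('[t.1, da_kernel H2 z] *: t.2 + c).
  rewrite -[tens F _ _]scale1r -[_ *: t.2]scale1r; apply: is_valueP => //.
  exact: is_value_tens.
have near_S (e : R[i]) : 0 < e -> exists2 x, S x & `|xi - x| < e.
  move=> e0.
  have [||x [hx /span_S Sx]] := @tens_dense _ _ _ _ F (ball xi e).
  - by exists xi; apply: ballxx.
  - exact: ball_open.
  - by exists x => //; rewrite -ball_normE in hx.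
pose g (x : F) : C := value_at x z.
have gP x : S x -> is_value x z (g x).
  by move=> hx; apply: xgetPex.
pose k := 1 + `|da_kernel H2 z|.
have k0 : 0 < k by rewrite ltr_pwDl.
have gB x y : S x -> S y -> `|g x - g y| <= k * `|x - y|.
  move=> /gP hx /gP hy.
  have := norm_value (is_valueP (-1) hy hx); rewrite !scaleN1r ![- _ + _]addrC.
  by move/le_trans; apply; rewrite ler_wpM2r // /k lerDr.
pose G := g @ within S (nbhs xi).
have PF : ProperFilter (within S (nbhs xi)).
  apply: Build_ProperFilter_ex => A /= /nbhs_ballP[e e0 hA].
  by have [x Sx hx] := near_S e e0; exists x; apply: hA => //; rewrite -ball_normE.
have near_ball (e : R[i]) : 0 < e -> \forall x \near within S (nbhs xi), `|xi - x| < e.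
  move=> e0; apply/nbhs_ballP; exists e => // x.
  by rewrite -ball_normE /=.
have near_in : \forall x \near within S (nbhs xi), S x.
  exact: withinT.
have cG : cvg G.
  apply/cauchy_cvgP/cauchy_exP => e e0.
  have e'0 : 0 < e / 2 / k by rewrite !divr_gt0.
  have [x Sx hx] := near_S _ e'0; exists (g x).
  rewrite /G /fmap /=.
  apply: (@filterS _ (within S (nbhs xi)) _ _ _ _
    (filterI near_in (near_ball _ e'0))) => y [Sy hy] /=.
  rewrite -ball_normE /=.
  apply: le_lt_trans (gB _ _ Sx Sy) _.
  rewrite -ltr_pdivlMl // mulrC -(subrKA xi).
  rewrite (le_lt_trans (ler_normD _ _)) // [e]splitr mulrDl.
  by rewrite ltrD // distrC.
exists (lim G) => eta; apply/eqP; rewrite -subr_eq0 -normr_le0.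
set T := tens F _ _.
apply/ler_addgt0Pr => e e0; rewrite add0r.
pose L := 1 + `|eta| + `|T|.
have L0 : 0 < L by rewrite /L -addrA ltr_pwDl // addr_ge0.
have e'0 : 0 < e / L by rewrite divr_gt0.
have /nbhs_ballP hc : nbhs (lim G) (ball (lim G) (e / L)) by apply: nbhsx_ballx.
have /cG /= hG : nbhs (lim G) (ball (lim G) (e / L)) by apply: nbhsx_ballx.
have [x [[Sx hx] hgx]] := filter_ex (filterI (filterI near_in (near_ball _ e'0)) hG).
rewrite -ball_normE /= in hgx.
have -> : '[lim G, eta] - '[xi, T] = '[lim G - g x, eta] - '[xi - x, T].
  by rewrite !innerBl (gP _ Sx) opprB addrA subrK.
rewrite (le_trans (ler_normB _ _)) //.
rewrite (le_trans (lerD (cauchy_schwarz _ _) (cauchy_schwarz _ _))) //.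
apply: (@le_trans _ _ (e / L * `|eta| + e / L * `|T|)).
  by rewrite lerD // ler_wpM2r // ltW.
rewrite -mulrDr mulrAC ler_pdivrMr // ler_wpM2l // ?ltW //.
by rewrite /L -addrA ltrDr.
Qed.

Lemma value_atP xi z : is_value xi z (value_at xi z).
Proof. by apply: xgetPex; apply: value_exists. Qed.

End Value.

Section LocalizedMap.
Variables (D C : hilbertType R) (F : freeModule H2 D) (G : freeModule H2 C).

Definition localize (Phi : {linear F -> G}) (z : 'rV[R[i]]_d) (eta : D) : C :=
  value_at (Phi (tens F (da_one H2) eta)) z.

Fact localize_is_linear (Phi : {linear F -> G}) z : linear (localize Phi z).
Proof.
move=> a eta eta'; apply: is_value_unique; first exact: value_atP.
by rewrite linearPr linearP; apply: is_valueP; apply: value_atP.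
Qed.
HB.instance Definition _ (Phi : {linear F -> G}) z :=
  GRing.isLinear.Build R[i] D C *:%R (localize Phi z) (localize_is_linear Phi z).

End LocalizedMap.
End Localization.

Definition pure (R : realType) (d : nat) (H2 : druryArveson R d)
    (H : hilbertModType R d) : Prop :=
  exists (C : hilbertType R) (F : freeModule H2 C) (K : set F)
         (U : {linear H -> F}),
    [/\ closed_submodule K,
        forall x, `|U x| = `|x|,
        range U = orthocomp K &
        forall p x, is_orthoproj (orthocomp K) (act p (U x)) (U (act p x))].

(** [Phi0] is the map onto [H] and [Phi i] is the map from the [(i+1)]-st to
    the [i]-th free module. *)
Record free_resolution (R : realType) (d : nat) (H2 : druryArveson R d)
    (H : hilbertModType R d) (C : nat -> hilbertType R)
    (F : forall i, freeModule H2 (C i))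
    (Phi0 : {linear F 0%N -> H}) (Phi : forall i, {linear F i.+1 -> F i}) : Prop :=
  FreeResolution {
    res_hom0 : module_hom Phi0 ;
    res_hom : forall i, module_hom (Phi i) ;
    res_isom0 : partially_isometric Phi0 ;
    res_isom : forall i, partially_isometric (Phi i) ;
    res_surj : range Phi0 = setT ;
    res_exact0 : [set x | Phi0 x = 0] = range (Phi 0%N) ;
    res_exact : forall i, [set x | Phi i x = 0] = range (Phi i.+1)
  }.

Section Koszul.
Variables (R : realType) (d : nat) (H : hilbertModType R d).

(** [H (x) /\^k C^d]: [w S] is the coefficient of
    [e_{i_1} /\ ... /\ e_{i_k}], where [S = {i_1 < ... < i_k}]. *)
Definition koszul_space (k : nat) : Type :=
  {ffun {S : {set 'I_d} | #|S| == k} -> H}.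
HB.instance Definition _ k := GRing.Lmodule.on (koszul_space k).

Definition wedge (k : nat) (x : H) (S : {set 'I_d}) : koszul_space k :=
  [ffun T => if val T == S then x else 0].

(** The index [i] is the [j]-th element of [S] when [j - 1] elements of [S] are
    smaller than [i], so that its sign is [(-1)^(j+1) = (-1)^(j-1)]. *)
Definition koszul (k : nat) (w : koszul_space k.+1) : koszul_space k :=
  \sum_(S : {S : {set 'I_d} | #|S| == k.+1}) \sum_(i in val S)
    (-1) ^+ #|[set j in val S | (j < i)%N]%SET| *:
      wedge k (act (coordX R i) (w S)) (val S :\ i)%SET.

Fact wedge_is_linear k S : linear (wedge k ^~ S).
Proof.
move=> a x y; apply/ffunP => T; rewrite !ffunE.
by case: ifP; rewrite ?scaler0 ?addr0.
Qed.

Fact koszul_is_linear k : linear (@koszul k).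
Proof.
move=> a v w; rewrite /koszul scaler_sumr -big_split; apply: eq_bigr => S _ /=.
rewrite scaler_sumr -big_split; apply: eq_bigr => i _ /=.
by rewrite !ffunE linearP wedge_is_linear scalerDr !scalerA mulrC.
Qed.
Lemma koszul_wedge k x (S : {set 'I_d}) : #|S| = k.+1 ->
  koszul (wedge k.+1 x S) = \sum_(i in S)
    (-1) ^+ #|[set j in S | (j < i)%N]%SET| *:
      wedge k (act (coordX R i) x) (S :\ i)%SET.
Proof.
move=> /eqP cS; rewrite /koszul (bigD1 (Sub S cS)) //= [X in _ + X]big1 ?addr0.
  by apply: eq_bigr => i _; rewrite ffunE /= eqxx.
move=> T; rewrite -val_eqE /= => /negPf nTS; apply: big1 => i _.
rewrite ffunE nTS linear0 (_ : wedge k 0 _ = 0) ?scaler0 //.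
by apply/ffunP => T'; rewrite !ffunE if_same.
Qed.

HB.instance Definition _ k :=
  GRing.isLinear.Build R[i] (koszul_space k.+1) (koszul_space k) *:%R
    (@koszul k) (@koszul_is_linear k).

End Koszul.
Arguments koszul {R d} H k w.

(* Main.v *)
Require Import Defs.
From HB Require Import structures.
From mathcomp Require Import all_boot all_order all_algebra.
From mathcomp Require Import all_classical all_reals all_analysis.
From mathcomp Require Import complex.
From mathcomp Require Import ring lra.
From mathcomp Require mpoly.

(** The two homologies are the two ways of reading a double complex.  Its rows
    are the resolution, with coefficients in the exterior powers; its columns
    are the Koszul complexes of the free modules.  The rows are exact by
    hypothesis.  The column of a free module [H^2 (x) C] is exact in positive
    degrees, and the sums [z_1 xi_1 + ... + z_d xi_d] in it are exactly the
    functions that vanish at the origin, so that its homology in degree 0 is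
    [C] through [xi |-> xi(0)].  A diagram chase along the diagonal then
    carries the Koszul homology of [H] to that of the localized complex.

    The analytic content is the exactness of the columns.  On power series the
    Koszul differential has the contracting homotopy of the polynomial
    Poincare lemma: with [h] the sum over [j] of the derivative in [z_j]
    followed by the exterior product with [e_j], the sum of [partial h] and
    [h partial] multiplies a [k]-form with homogeneous coefficients of degree
    [n] by [n + k] ([boundary_euler]).  A cycle is thus the boundary of [h]
    applied to its degree-wise quotient by [n + k], provided that these series
    belong to the free module.  They do: monomials are orthogonal in [H^2],
    with squared norm [a! / |a|!] ([mono_ortho]), and with these weights
    deriving in [z_j] and dividing by [n + k] does not increase norms
    ([deriv_exists]).

    The norms of the monomials have to be extracted from the reproducing
    kernel.  The kernel function at [w] is the sum of the powers of the linear
    form [<., w>] up to a remainder of order [n] ([kernel_expansion]), so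
    rescaling [w] and comparing powers of the scaling factor gives the inner
    product of a homogeneous polynomial with [<., w>^n] ([inner_kernel_form]);
    differentiating this identity in [w] gives the inner products of all
    monomials ([polarization]).  The same expansion shows that no nonzero
    vector is orthogonal to the polynomials ([mono_total]), so a vector of the
    free module is determined by its Taylor coefficients, and every square
    summable family of coefficients occurs ([riesz_fischer]). *)

Set Implicit Arguments.
Unset Strict Implicit.
Unset Printing Implicit Defensive.

Import Order.TTheory GRing.Theory Num.Theory.
Import numFieldNormedType.Exports.

Local Open Scope classical_set_scope.
Local Open Scope complex_scope.
Local Open Scope ring_scope.

(** * Hilbert spaces: Riesz representation and orthogonal series *)

Section HilbertSpace.
Variables (R : realType) (H : hilbertType R).
Implicit Types (x y z : H).

Lemma innerDr x y z : '[x, y + z] = '[x, y] + '[x, z].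
Proof. by rewrite innerC innerDl rmorphD /= -!innerC. Qed.

Lemma inner0r x : '[x, 0] = 0.
Proof. by rewrite innerC inner0l rmorph0. Qed.

Lemma innerNl x y : '[- x, y] = - '[x, y].
Proof. by rewrite -scaleN1r innerZl mulN1r. Qed.

Lemma inner_suml I (r : seq I) (P : pred I) (F : I -> H) y :
  '[\sum_(i <- r | P i) F i, y] = \sum_(i <- r | P i) '[F i, y].
Proof. by elim/big_rec2: _ => [|i a b _ <-]; rewrite ?inner0l ?innerDl. Qed.

Lemma inner_sumr I (r : seq I) (P : pred I) (F : I -> H) y :
  '[y, \sum_(i <- r | P i) F i] = \sum_(i <- r | P i) '[y, F i].
Proof. by elim/big_rec2: _ => [|i a b _ <-]; rewrite ?inner0r ?innerDr. Qed.

(** Norms take values in [R[i]]; limits and infima are taken in [R]. *)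
Definition sqnorm x : R := complex.Re '[x, x].

Lemma sqnormE x : '[x, x] = (sqnorm x)%:C.
Proof. by rewrite RRe_real // ger0_real // inner_ge0. Qed.

Lemma sqnorm_ge0 x : 0 <= sqnorm x.
Proof. by rewrite -ler0c -sqnormE inner_ge0. Qed.

Lemma sqnorm_eq0 x : sqnorm x = 0 -> x = 0.
Proof.
move=> x0; apply/eqP; rewrite -normr_eq0 -sqrf_eq0 normr_inner sqnormE x0.
by rewrite eqxx.
Qed.

Lemma sqnormN x : sqnorm (- x) = sqnorm x.
Proof. by rewrite /sqnorm innerNl (innerC x) innerNl rmorphN /= -innerC opprK. Qed.

Lemma norm_sqnorm x : `|x| ^+ 2 = (sqnorm x)%:C.
Proof. by rewrite normr_inner sqnormE. Qed.

Lemma ReD (a b : R[i]) : complex.Re (a + b) = complex.Re a + complex.Re b.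
Proof. by case: a; case: b. Qed.
Lemma ReB (a b : R[i]) : complex.Re (a - b) = complex.Re a - complex.Re b.
Proof. by case: a; case: b. Qed.
Lemma ReJ (a : R[i]) : complex.Re a^* = complex.Re a.
Proof. by case: a. Qed.
Lemma ReZ (a : R) (b : R[i]) : complex.Re (a%:C * b) = a * complex.Re b.
Proof. by case: b => b c /=; rewrite mul0r subr0. Qed.

Lemma sqnormD x y : sqnorm (x + y) = sqnorm x + sqnorm y + 2 * complex.Re '[x, y].
Proof.
rewrite /sqnorm innerDl !innerDr !ReD (innerC y x) ReJ; lra.
Qed.

Lemma sqnormB x y : sqnorm (x - y) = sqnorm x + sqnorm y - 2 * complex.Re '[x, y].
Proof.
rewrite sqnormD sqnormN -[- y]scaleN1r innerZr rmorphN1 mulN1r.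
by rewrite (_ : complex.Re (- _) = - complex.Re '[x, y]) ?mulrN //; case: '[x, y].
Qed.

Lemma sqnormZ (a : R[i]) x : (sqnorm (a *: x))%:C = `|a| ^+ 2 * (sqnorm x)%:C.
Proof. by rewrite -!norm_sqnorm normrZ exprMn. Qed.

Lemma sqr_inner_le x y : `|'[x, y]| ^+ 2 <= (sqnorm x * sqnorm y)%:C.
Proof.
rewrite rmorphM /= -!norm_sqnorm -exprMn ler_sqr ?nnegrE ?mulr_ge0 //.
exact: cauchy_schwarz.
Qed.

Definition norm_cvg (u : nat -> H) x := (fun n => sqnorm (x - u n)) @ \oo --> (0 : R).

Lemma cvg_near0 (e : R^nat) : e @ \oo --> 0 -> forall d : R, 0 < d ->
  exists N, forall n, (N <= n)%N -> e n < d.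
Proof.
move=> ecvg d d0.
have : \forall n \near \oo, e n < d by apply: (cvgr_lt _ ecvg).
by move=> [N _ hN]; exists N.
Qed.

Lemma near0_cvg (e : R^nat) : (forall n, 0 <= e n) ->
  (forall d : R, 0 < d -> exists N, forall n, (N <= n)%N -> e n < d) ->
  e @ \oo --> 0.
Proof.
move=> e0 he; apply/cvgrPdist_lt => d d0.
have [N hN] := he _ d0; exists N => // n /= Nn.
by rewrite sub0r normrN ger0_norm // hN.
Qed.

(** The form in which completeness is used for minimizing sequences, where the
    bound comes from the parallelogram identity, and for partial sums, where it
    is the tail of a convergent series. *)
Lemma norm_cvg_cauchy (u : nat -> H) (e : R^nat) : e @ \oo --> 0 ->
  (forall m n, sqnorm (u m - u n) <= e m + e n) -> exists x, norm_cvg u x.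
Proof.
move=> ecvg ue.
have ucvg : cvg (u @ \oo).
  apply/cauchy_cvgP/cauchy_exP => d d0.
  have rd : complex.Re d > 0 by move: d0; rewrite ltcE /= => /andP[].
  have dE : d = (complex.Re d)%:C by rewrite RRe_real // gtr0_real.
  have d2 : 0 < (complex.Re d) ^+ 2 / 2 by rewrite divr_gt0 // exprn_gt0.
  have [N hN] := cvg_near0 ecvg d2.
  exists (u N), N => // n /= Nn; rewrite -ball_normE /=.
  rewrite -ltr_sqr ?nnegrE ?(ltW d0) //.
  have -> : `|u N - u n| ^+ 2 = (sqnorm (u N - u n))%:C by exact: norm_sqnorm.
  rewrite [in ltRHS]dE -rmorphXn ltcR.
  rewrite (le_lt_trans (ue _ _)) // [ltRHS]splitr ltrD //; apply: hN => //.
exists (lim (u @ \oo)); apply: near0_cvg => [n|d d0]; first exact: sqnorm_ge0.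
have sd : 0 < (Num.sqrt d)%:C :> R[i] by rewrite (@ltcR _ 0) sqrtr_gt0.
move/cvgrPdist_lt: ucvg => /(_ _ sd)[N _ hN]; exists N => n /hN /=.
rewrite -ltr_sqr ?nnegrE ?(ltW sd) //.
have -> : `|lim (u @ \oo) - u n| ^+ 2 = (sqnorm (lim (u @ \oo) - u n))%:C.
  exact: norm_sqnorm.
by rewrite -rmorphXn ltcR sqr_sqrtr // ltW.
Qed.

Lemma sqr_normcD (a b : R[i]) : `|a + b| ^+ 2 <= 2 * (`|a| ^+ 2 + `|b| ^+ 2).
Proof.
rewrite -!add_Re2_Im2 -(rmorph_nat (real_complex R)) -rmorphD -rmorphM lecR.
case: a b => [a1 a2] [b1 b2] /=.
have := sqr_ge0 (a1 - b1); have := sqr_ge0 (a2 - b2); nra.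
Qed.

(** Inner products with the limit are found from an explicit rate [e], in the form
    in which estimates on the approximating vectors come. *)
Lemma norm_cvg_inner (u : nat -> H) x y (l : R[i]) (e : R^nat) :
  norm_cvg u x -> e @ \oo --> 0 -> (forall n, `|'[u n, y] - l| ^+ 2 <= (e n)%:C) ->
  '[x, y] = l.
Proof.
move=> ux e0 he; apply/eqP; rewrite -subr_eq0 -normr_eq0 -sqrf_eq0.
have -> : `|'[x, y] - l| ^+ 2 = (complex.Re (`|'[x, y] - l| ^+ 2))%:C.
  by rewrite RRe_real // ger0_real // exprn_ge0.
set r := complex.Re _.
have rE : r%:C = `|'[x, y] - l| ^+ 2 by rewrite RRe_real // ger0_real // exprn_ge0.
have rle n : r <= 2 * (sqnorm (x - u n) * sqnorm y + e n).
  rewrite -lecR rE (_ : _ - l = '[x - u n, y] + ('[u n, y] - l)); last first.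
    by rewrite innerBl addrA subrK.
  rewrite (le_trans (sqr_normcD _ _)) // rmorphM rmorph_nat ler_wpM2l //.
  by rewrite rmorphD lerD // sqr_inner_le.
have cv : (fun n => 2 * (sqnorm (x - u n) * sqnorm y + e n)) @ \oo --> (0 : R).
  rewrite -[X in _ --> X](_ : 2 * (0 * sqnorm y + 0) = 0); last by rewrite mul0r addr0 mulr0.
  by apply: cvgM; [exact: cvg_cst|apply: cvgD => //; apply: cvgM => //; exact: cvg_cst].
have r_le0 : r <= 0.
  rewrite leNgt; apply/negP => /(cvg_near0 cv)[N /(_ N (leqnn _))].
  by rewrite ltNge rle.
suff -> : r = 0 by [].
by apply/eqP; rewrite eq_le r_le0 -lecR rE exprn_ge0.
Qed.

Lemma sqnorm_half x y : 4 * sqnorm (2^-1 *: (x + y)) = sqnorm (x + y).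
Proof.
apply: complexI; rewrite rmorphM /= sqnormZ normfV ger0_norm //.
rewrite -(rmorph_nat (real_complex R)) mulrA -[RHS]mul1r; congr (_ * _).
by rewrite rmorph_nat; field.
Qed.

(** The representing vector minimizes [J x = |x|^2 - 2 Re (psi x)]: the
    parallelogram identity makes every minimizing sequence [u] a Cauchy
    sequence, and comparing [J (u n)] with [J] at a nearby point in the
    direction of [z] forces [<z, u n>] to tend to [psi z]. *)
Lemma riesz (psi : H -> R[i]) (M : R) :
  (forall a x y, psi (a *: x + y) = a * psi x + psi y) ->
  (forall x, `|psi x| ^+ 2 <= (M * sqnorm x)%:C) ->
  exists y, forall x, psi x = '[x, y].
Proof.
move=> psiP psiM.
have psi0 : psi 0 = 0.
  apply: (@addrI _ (psi 0)); rewrite addr0.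
  by have := psiP 1 0 0; rewrite scaler0 addr0 mul1r => <-.
have psiD x y : psi (x + y) = psi x + psi y by rewrite -[x]scale1r psiP scale1r mul1r.
have psiZ a x : psi (a *: x) = a * psi x by rewrite -[a *: x]addr0 psiP psi0 addr0.
pose J x := sqnorm x - 2 * complex.Re (psi x).
have Jge x : - `|M| <= J x.
  have := psiM x; rewrite -add_Re2_Im2 lecR => hM.
  have h1 : (complex.Re (psi x)) ^+ 2 <= `|M| * sqnorm x.
    rewrite (le_trans _ (ler_wpM2r (sqnorm_ge0 x) (ler_norm M))) //.
    by rewrite (le_trans _ hM) // lerDl sqr_ge0.
  have s0 := sqnorm_ge0 x; have M0 := normr_ge0 M.
  rewrite /J; suff : 2 * complex.Re (psi x) <= sqnorm x + `|M| by lra.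
  have [p0|p0] := leP (complex.Re (psi x)) 0; first by lra.
  rewrite -ler_sqr ?nnegrE; try lra.
  have := sqr_ge0 (sqnorm x - `|M|); nra.
have hinf : has_inf (range J).
  split; first by exists (J 0), 0.
  by exists (- `|M|) => _ [x _ <-].
pose d := inf (range J).
have dJ x : d <= J x by apply: ge_inf; [case: hinf|exists x].
have /choice[u hu] : forall n : nat, exists x, J x < d + n.+1%:R^-1.
  move=> n; have n0 : 0 < n.+1%:R^-1 :> R by rewrite invr_gt0.
  by have [_ [x _ <-] hx] := inf_adherent n0 hinf; exists x.
have par x y : sqnorm (x - y) = 2 * J x + 2 * J y - 4 * J (2^-1 *: (x + y)).
  rewrite /J mulrBr mulrBr mulrBr sqnorm_half psiZ psiD.
  rewrite -[2^-1](_ : (2^-1 : R)%:C = _) ?ReZ ?ReD; last first.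
    by rewrite fmorphV rmorph_nat.
  by rewrite sqnormB sqnormD; field.
have ecvg : (fun n : nat => 2 * n.+1%:R^-1 : R) @ \oo --> 0.
  by rewrite -[X in _ --> X](mulr0 2); apply: cvgM; [exact: cvg_cst|exact: cvg_harmonic].
have [y uy] : exists y, norm_cvg u y.
  apply: (norm_cvg_cauchy ecvg) => m n /=; rewrite par.
  have := hu m; have := hu n; have := dJ (2^-1 *: (u m + u n)).
  set a := J (u m); set b := J (u n); set e1 := m.+1%:R^-1; set e2 := n.+1%:R^-1.
  lra.
exists y => z; rewrite innerC.
(* Moving [u n] along [z] by minus the conjugate of [c] over [k], with [c] the
   defect of [u n] at [z], lowers
   [J] by at least [|c|^2 / k], which is thus at most [1 / (n + 1)]. *)
pose k := 1 + sqnorm z.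
have k0 : 0 < k by rewrite ltr_pwDl // sqnorm_ge0.
have cv : (fun n => k * n.+1%:R^-1 : R) @ \oo --> 0.
  by rewrite -[X in _ --> X](mulr0 k); apply: cvgM; [exact: cvg_cst|exact: cvg_harmonic].
suff -> : '[y, z] = (psi z)^* by rewrite conjCK.
apply: (norm_cvg_inner uy cv) => n.
pose c := '[z, u n] - psi z.
have -> : `|'[u n, z] - (psi z)^*| ^+ 2 = `|c| ^+ 2.
  by rewrite -[in RHS]norm_conjC rmorphB /= -innerC.
pose q := complex.Re (`|c| ^+ 2).
have qE : q%:C = `|c| ^+ 2 by rewrite RRe_real // ger0_real // exprn_ge0.
rewrite -qE lecR.
have psiB b : psi (u n - b *: z) = psi (u n) - b * psi z.
  by rewrite -scaleNr psiD psiZ mulNr.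
have := dJ (u n - (k^-1%:C * c^*) *: z); have := hu n.
rewrite /J psiB sqnormB innerZr rmorphM /= conjCK.
set w := ((k^-1)%:C)^*; have -> : w = (k^-1)%:C by exact: conjc_real.
have -> : sqnorm (((k^-1)%:C * c^*) *: z) = k^-1 ^+ 2 * q * sqnorm z.
  apply: complexI; rewrite sqnormZ normrM norm_conjC exprMn -qE !rmorphM; congr (_ * _ * _).
  by rewrite ger0_norm ?expr2 // ler0c invr_ge0 ltW.
rewrite ReB -!mulrA !ReZ.
have -> : complex.Re (c * '[u n, z]) = q + complex.Re (c^* * psi z).
  rewrite /q normCK (innerC (u n)) -[in c * _](subrK (psi z) '[z, u n]) -/c.
  rewrite rmorphD mulrDr ReD; congr (_ + _).
  by rewrite -[in LHS]ReJ rmorphM /= conjCK.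
set t := complex.Re (c^* * psi z).
have -> : sqnorm z = k - 1 by rewrite /k addrC addKr.
have q0 : 0 <= q by rewrite -ler0c qE exprn_ge0.
have kk : k^-1 * k = 1 by rewrite mulVf // gt_eqF.
have kV : 0 < k^-1 by rewrite invr_gt0.
set N := n.+1%:R^-1; set P := complex.Re (psi (u n)); set S := sqnorm (u n).
move=> h1 h2; have h3 : k^-1 * q <= N.
  have : k^-1 * (k^-1 * (q * (k - 1))) = k^-1 * q - k^-1 * (k^-1 * q).
    rewrite (_ : k^-1 * (q * (k - 1)) = k^-1 * k * q - k^-1 * q); last by ring.
    by rewrite kk mul1r mulrBr.
  have := mulr_ge0 (ltW kV) (mulr_ge0 (ltW kV) q0).
  lra.
by rewrite -/N -(ler_pM2l kV) mulrA kk mul1r.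
Qed.

(** The squared norm of a block of terms is a difference of the bounded,
    nondecreasing partial sums of squared norms. *)
Lemma orthogonal_series (u : nat -> H) (B : R) :
  (forall m n, m != n -> '[u m, u n] = 0) ->
  (forall N, \sum_(0 <= n < N) sqnorm (u n) <= B) ->
  exists x, norm_cvg (fun N => \sum_(0 <= n < N) u n) x.
Proof.
move=> uo uB; pose r N := \sum_(0 <= n < N) sqnorm (u n).
have rnd : nondecreasing_seq r.
  by apply/nondecreasing_seqP => n; rewrite /r big_nat_recr //= lerDl sqnorm_ge0.
have rub : has_ubound (range r) by exists B => _ [n _ <-]; exact: uB.
have rcv := nondecreasing_cvgn rnd rub.
set L := sup _ in rcv.
have rL n : r n <= L by apply: ub_le_sup => //; exists n.
have sq m n : (m <= n)%N -> sqnorm (\sum_(m <= i < n) u i) = r n - r m.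
  move=> mn; rewrite /r (big_cat_nat (leq0n m) mn) //= addrAC subrr add0r.
  rewrite /sqnorm inner_suml.
  rewrite (big_morph _ ReD (erefl (complex.Re 0))).
  apply: eq_big_nat => i /andP[mi iN].
  rewrite inner_sumr (bigD1_seq i) ?mem_index_iota ?mi ?iota_uniq //=.
  by rewrite big1 ?addr0 // => j ji; rewrite uo // eq_sym.
apply: (@norm_cvg_cauchy _ (fun n => L - r n)).
  by rewrite -(subrr L); apply: cvgB => //; exact: cvg_cst.
move=> m n; wlog mn : m n / (m <= n)%N.
  move=> hw; case/orP: (leq_total m n) => [/hw//|/hw].
  by rewrite -sqnormN opprB [e in _ <= e]addrC.
rewrite -sqnormN opprB (big_cat_nat (leq0n m) mn) //= addrAC subrr add0r sq //.
by have := rL m; have := rL n; rewrite /=; lra.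
Qed.

End HilbertSpace.

(** * The Drury-Arveson space: inner products of monomials *)

Section PolynomialIdentities.
Variable (R : realType).

Lemma eq_poly_horner (p q : {poly R[i]}) : (forall t, p.[t] = q.[t]) -> p = q.
Proof.
move=> pq; apply/eqP; rewrite -subr_eq0; apply/eqP.
apply: (@roots_geq_poly_eq0 _ _ [seq i%:R | i <- iota 0 (size (p - q))]).
- by apply/allP => t _; rewrite /root hornerD hornerN pq subrr.
- by rewrite map_inj_uniq ?iota_uniq // => i j /eqP; rewrite eqr_nat => /eqP.
- by rewrite size_map size_iota.
Qed.

(** Uniqueness of Taylor polynomials at 0: the constant term vanishes in the
    limit, and the quotient by the variable satisfies the bound of order [n - 1]. *)
Lemma poly_small_eq0 (p : {poly R[i]}) (K : R) (n : nat) : (size p <= n)%N ->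
  (forall t : R, 0 < t < 1 -> `|p.[t%:C]| <= (K * t ^+ n)%:C) -> p = 0.
Proof.
elim: n p => [|n IHn] p; first by rewrite leqn0 size_poly_eq0 => /eqP.
have [q [a ->]] : exists q a, p = q * 'X + a%:P.
  by elim/poly_ind: p => [|q a _]; [exists 0, 0; rewrite mul0r addr0|exists q, a].
move=> sq hp.
have sqn : (size q <= n)%N.
  have [->|q0] := eqVneq q 0; first by rewrite size_poly0.
  by move: sq; rewrite size_MXaddC (negPf q0).
pose B := \sum_(i < size q) complex.Re `|q`_i|.
have qB (t : R) : 0 < t < 1 -> `|q.[t%:C]| <= B%:C.
  move=> /andP[t0 t1]; rewrite horner_coef (le_trans (ler_norm_sum _ _ _)) //.
  have -> : B%:C = \sum_(i < size q) `|q`_i|.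
    rewrite /B rmorph_sum; apply: eq_bigr => i _.
    by apply: RRe_real; exact: normr_real.
  rewrite ler_sum // => i _; rewrite normrM normrX ler_piMr //.
  by rewrite exprn_ile1 // ger0_norm ?ler0c ?(@lecR _ _ 1) ltW.
have a0 : a = 0.
  apply/eqP; rewrite -normr_le0; apply/ler_addgt0Pr => e e0; rewrite add0r.
  have eE : e = (complex.Re e)%:C by rewrite RRe_real // gtr0_real.
  move: e0; rewrite eE ltcR => e0.
  pose L := 1 + `|B| + `|K|.
  have L0 : 0 < L by rewrite /L -addrA ltr_pwDl // addr_ge0.
  pose t := Num.min (2^-1) (complex.Re e / L).
  have t0 : 0 < t by rewrite lt_min invr_gt0 ltr0n divr_gt0.
  have t1 : t < 1 by rewrite gt_min invf_lt1 ?ltr1n ?ltr0n.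
  have te : t * L <= complex.Re e by rewrite -ler_pdivlMr // ge_min lexx orbT.
  have t01 : 0 < t < 1 by rewrite t0.
  rewrite -[a](addKr (q.[t%:C] * t%:C)) (le_trans (ler_normD _ _)) //.
  have -> : q.[t%:C] * t%:C + a = (q * 'X + a%:P).[t%:C] by rewrite !hornerE.
  rewrite normrN normrM (@ger0_norm _ t%:C) ?ler0c ?(ltW t0) //.
  apply: (@le_trans _ _ (B%:C * t%:C + (K * t ^+ n.+1)%:C)).
    by rewrite lerD ?hp // ler_wpM2r ?ler0c ?(ltW t0) ?qB.
  rewrite -rmorphM -rmorphD lecR (le_trans _ te) //.
  have h1 : t ^+ n.+1 <= t by rewrite exprS ler_piMr ?(ltW t0) // exprn_ile1 // ltW.
  have h2 : K * t ^+ n.+1 <= `|K| * t.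
    rewrite (le_trans (ler_wpM2r _ (ler_norm K))) ?exprn_ge0 ?(ltW t0) //.
    by rewrite ler_wpM2l.
  have h3 : B * t <= `|B| * t by rewrite ler_wpM2r ?ler_norm // ltW.
  rewrite /L; move: h2 h3 t0; set T := t ^+ n.+1; lra.
rewrite a0 addr0 (IHn q sqn) ?mul0r // => t t01.
have /andP[t0 _] := t01.
have := hp t t01; rewrite a0 addr0 hornerMX normrM.
rewrite (@ger0_norm _ t%:C) ?ler0c ?(ltW t0) // exprSr mulrA rmorphM /=.
by rewrite ler_pM2r // ltcR.
Qed.

End PolynomialIdentities.

Section Kernel.
Variables (R : realType) (d : nat) (H2 : druryArveson R d).
Local Notation mpol := (mpoly.mpoly d R[i]).
Local Notation mnm := (mpoly.multinom d).
Implicit Types (p q : mpol) (f g : H2) (w z : 'rV[R[i]]_d).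

Local Notation K := (da_kernel H2).
Definition da_poly p : H2 := act p (da_one H2).

Lemma da_evalE f z : unit_ball z -> da_eval f z = '[f, K z].
Proof. exact: da_reproducing. Qed.

Lemma act_kernel p f z : unit_ball z ->
  '[act p f, K z] = mpoly.meval (z 0) p * '[f, K z].
Proof. by move=> zB; rewrite -!da_evalE // da_actE. Qed.

Lemma da_poly_kernel p z : unit_ball z -> '[da_poly p, K z] = mpoly.meval (z 0) p.
Proof. by move=> zB; rewrite act_kernel // -da_evalE // da_oneE // mulr1. Qed.

Lemma da_inner_ext f g :
  (forall z, unit_ball z -> '[f, K z] = '[g, K z]) -> f = g.
Proof. by move=> fg; apply: da_ext => z zB; rewrite !da_evalE // fg. Qed.

(** Arithmetic-geometric means suffice, as both points have norm less than 1. *)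
Lemma dotC_lt1 z w : unit_ball z -> unit_ball w -> `|dotC z w| < 1.
Proof.
rewrite /unit_ball /= => zB wB.
have h : `|dotC z w| <= (\sum_k `|z 0 k| ^+ 2 + \sum_k `|w 0 k| ^+ 2) / 2.
  rewrite (le_trans (ler_norm_sum _ _ _)) // -big_split /= mulr_suml ler_sum // => k _.
  rewrite normrM norm_conjC.
  rewrite ler_pdivlMr // -subr_ge0.
  rewrite (_ : _ - _ = (`|z 0 k| - `|w 0 k|) ^+ 2); last by ring.
  by rewrite -realEsqr rpredB // normr_real.
rewrite (le_lt_trans h) // ltr_pdivrMr // mul1r (_ : 2 = 1 + 1) //.
by rewrite ltrD.
Qed.

(** The linear form [<., w>]. *)
Definition kernel_form w : mpol := \sum_j (w 0 j)^* *: coordX R j.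

Lemma meval_kernel_form z w : mpoly.meval (z 0) (kernel_form w) = dotC z w.
Proof.
rewrite /kernel_form raddf_sum /=; apply: eq_bigr => j _.
by rewrite mpoly.mevalZ mpoly.mevalXU mulrC.
Qed.

(** The geometric series of [1 / (1 - <z, w>)] with its remainder, as an
    identity between vectors. *)
Lemma kernel_expansion n w : unit_ball w ->
  K w = \sum_(m < n) da_poly (kernel_form w ^+ m) + act (kernel_form w ^+ n) (K w).
Proof.
move=> wB; apply: da_inner_ext => z zB.
rewrite innerDl inner_suml act_kernel // rmorphXn /= meval_kernel_form.
under eq_bigr => m _ do rewrite da_poly_kernel // rmorphXn /= meval_kernel_form.
rewrite -!da_evalE // da_kernelE //; set t := dotC z w.
have t1 : 1 - t != 0.
  rewrite subr_eq0; apply: contraTneq (dotC_lt1 zB wB) => /esym.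
  by rewrite -/t => ->; rewrite normr1 ltxx.
apply: (mulfI t1); rewrite mulfV // mulrDr mulrCA mulfV // mulr1.
by rewrite -opprB mulNr -subrX1 opprB subrK.
Qed.

(** Stated through values because kernel functions are compared at rescaled
    points. *)
Definition homogeneous n p := forall t v,
  mpoly.meval (fun i => t * v i) p = t ^+ n * mpoly.meval v p.

Lemma homogeneous_kernel_form m w : homogeneous m (kernel_form w ^+ m).
Proof.
move=> t v; rewrite !rmorphXn /= -exprMn; congr (_ ^+ _).
rewrite /kernel_form !raddf_sum mulr_sumr; apply: eq_bigr => j _ /=.
by rewrite !mpoly.mevalZ !mpoly.mevalXU mulrCA.
Qed.

Lemma meval_mX (v : 'I_d -> R[i]) (a : mnm) :
  mpoly.meval v (mpoly.mpolyX R[i] a) = \prod_i v i ^+ a i.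
Proof. exact: mpoly.mevalX. Qed.

Lemma homogeneous_mX (a : mnm) : homogeneous (mpoly.mdeg a) (mpoly.mpolyX R[i] a).
Proof.
move=> t v; rewrite !meval_mX mpoly.mdegE (big_morph _ (exprD t) (expr0 t)) -big_split /=.
by apply: eq_bigr => i _; rewrite exprMn.
Qed.

Lemma actZ p c f : act (c *: p) f = c *: act p f.
Proof. by rewrite -mpoly.mul_mpolyC actM actC. Qed.

Lemma da_polyZ c p : da_poly (c *: p) = c *: da_poly p.
Proof. exact: actZ. Qed.

Lemma da_polyD p q : da_poly (p + q) = da_poly p + da_poly q.
Proof. exact: actDl. Qed.

Definition sqdot w : R := complex.Re (dotC w w).

Lemma sqdotE w : dotC w w = (sqdot w)%:C.
Proof.
rewrite /sqdot RRe_real // ger0_real // sumr_ge0 // => k _.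
by rewrite mul_conjC_ge0.
Qed.

Lemma sqdot_ge0 w : 0 <= sqdot w.
Proof. by rewrite -ler0c -sqdotE sumr_ge0 // => k _; rewrite mul_conjC_ge0. Qed.

Lemma unit_ballE w : unit_ball w = (sqdot w < 1) :> Prop.
Proof.
rewrite /unit_ball /= -ltcR -sqdotE; congr (is_true (_ < _)).
by apply: eq_bigr => k _; rewrite normCK.
Qed.

Lemma sqdotZ (t : R) w : sqdot (t%:C *: w) = t ^+ 2 * sqdot w.
Proof.
apply: complexI; rewrite rmorphM /= -!sqdotE /dotC mulr_sumr.
apply: eq_bigr => k _; rewrite !mxE rmorphM /=.
have -> : (t%:C)^* = t%:C by exact: conjc_real.
by rewrite rmorphXn /=; ring.
Qed.

Lemma kernel_formZ (t : R) w : kernel_form (t%:C *: w) = t%:C *: kernel_form w.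
Proof.
rewrite /kernel_form scaler_sumr; apply: eq_bigr => j _; rewrite mxE rmorphM /= scalerA.
by congr (_ * _ *: _); exact: conjc_real.
Qed.

Lemma sqnorm_kernel w : unit_ball w -> sqnorm (K w) = (1 - sqdot w)^-1.
Proof.
move=> wB; apply: complexI; rewrite -sqnormE -da_evalE // da_kernelE // sqdotE.
by rewrite fmorphV rmorphB.
Qed.

(** [da_act_bounded] derives this from the continuity of the action on a nonzero
    free module. *)
Definition da_bounded := forall p, exists M : R, forall f : H2,
  sqnorm (act p f) <= M * sqnorm f.

Hypothesis act_bounded : da_bounded.

(** Evaluating [p] at [t w] by the reproducing property and expanding the kernel
    gives [t^n p(w)] as a polynomial in [t], with the unknown inner products as
    coefficients, up to [O(t^N)]; the remainder is controlled because the
    kernel functions at the points [t w] are bounded. *)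
Lemma inner_kernel_form_ball n p m w : homogeneous n p -> unit_ball w ->
  '[da_poly p, da_poly (kernel_form w ^+ m)] = if m == n then mpoly.meval (w 0) p else 0.
Proof.
move=> hp wB.
pose c k := '[da_poly p, da_poly (kernel_form w ^+ k)] -
  (if k == n then mpoly.meval (w 0) p else 0).
suff: c m = 0 by move/eqP; rewrite subr_eq0 => /eqP.
pose N := (maxn n m).+1.
have mN : (m < N)%N by rewrite ltnS leq_maxr.
have nN : (n < N)%N by rewrite ltnS leq_maxl.
have [M hM] := act_bounded (kernel_form w ^+ N).
pose B := 1 + sqnorm (da_poly p) * (`|M| * (1 - sqdot w)^-1).
have S1 : sqdot w < 1 by rewrite -unit_ballE.
suff P0 : \poly_(k < N) c k = 0.
  by have := congr1 (fun p : {poly R[i]} => p`_m) P0; rewrite coef_poly mN coef0.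
apply: (@poly_small_eq0 _ _ B N); first exact: size_poly.
move=> t /andP[t0 t1].
pose tw := t%:C *: w.
have t21 : t ^+ 2 <= 1 by rewrite exprn_ile1 // ltW.
have Stw : sqdot tw <= sqdot w by rewrite sqdotZ ler_piMl // sqdot_ge0.
have twB : unit_ball tw by rewrite unit_ballE (le_lt_trans Stw).
have lE k : da_poly (kernel_form tw ^+ k) = (t ^+ k)%:C *: da_poly (kernel_form w ^+ k).
  by rewrite kernel_formZ exprZn da_polyZ -rmorphXn.
have rconj (a : R) : (a%:C)^* = a%:C by exact: conjc_real.
have E1 : '[da_poly p, K tw] = (t ^+ n)%:C * mpoly.meval (w 0) p.
  rewrite da_poly_kernel // rmorphXn -hp; apply: mpoly.meval_eq => j.
  by rewrite mxE.
have -> : (\poly_(k < N) c k).[t%:C] =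
    - (t ^+ N)%:C * '[da_poly p, act (kernel_form w ^+ N) (K tw)].
  rewrite horner_poly.
  have := E1; rewrite {1}(kernel_expansion N twB) innerDr inner_sumr.
  under eq_bigr => k _ do rewrite lE innerZr rconj.
  rewrite kernel_formZ exprZn actZ innerZr -rmorphXn rconj.
  move/eqP; rewrite -subr_eq0 addrAC addr_eq0 => /eqP E2.
  rewrite mulNr -E2.
  transitivity (\sum_(k < N) ('[da_poly p, da_poly (kernel_form w ^+ k)] * t%:C ^+ k -
      (if k == n :> nat then mpoly.meval (w 0) p else 0) * t%:C ^+ k)).
    by apply: eq_bigr => k _; exact: mulrBl.
  rewrite sumrB; congr (_ - _).
    by apply: eq_bigr => k _; rewrite mulrC rmorphXn.
  rewrite (bigD1 (Ordinal nN)) //= eqxx big1 ?addr0.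
    by rewrite mulrC rmorphXn.
  by move=> k; rewrite -val_eqE /= => /negPf ->; rewrite mul0r.
have tN : 0 <= t ^+ N by rewrite exprn_ge0 // ltW.
rewrite normrM normrN (@ger0_norm _ (t ^+ N)%:C) ?ler0c //.
rewrite mulrC rmorphM ler_wpM2r ?ler0c //.
have B0 : 0 <= sqnorm (da_poly p) * (`|M| * (1 - sqdot w)^-1).
  by rewrite !mulr_ge0 ?sqnorm_ge0 // invr_ge0 subr_ge0 ltW.
have B1 : 0 <= B%:C by rewrite ler0c addr_ge0.
rewrite -ler_sqr ?nnegrE //.
rewrite (le_trans (sqr_inner_le _ _)) // -rmorphXn lecR.
apply: (@le_trans _ _ (B - 1)); last by rewrite /B; nra.
rewrite /B [1 + _]addrC addrK ler_wpM2l ?sqnorm_ge0 // (le_trans (hM _)) //.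
rewrite (le_trans (ler_wpM2r (sqnorm_ge0 _) (ler_norm M))) // ler_wpM2l //.
by rewrite sqnorm_kernel // lef_pV2 ?posrE ?subr_gt0 ?(le_lt_trans Stw) // lerB.
Qed.

(** Both sides are homogeneous of the same degree in [w], so the restriction to
    the ball disappears. *)
Lemma inner_kernel_form n p m w : homogeneous n p ->
  '[da_poly p, da_poly (kernel_form w ^+ m)] = if m == n then mpoly.meval (w 0) p else 0.
Proof.
move=> hp; pose s := (1 + sqdot w)^-1.
have k0 : 0 < 1 + sqdot w by rewrite ltr_pwDl // sqdot_ge0.
have s0 : 0 < s by rewrite invr_gt0.
have swB : unit_ball (s%:C *: w).
  rewrite unit_ballE sqdotZ.
  have -> : sqdot w = s^-1 - 1 by rewrite invrK addrC addKr.
  rewrite expr2 mulrBr -mulrA mulfV ?gt_eqF // !mulr1.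
  have : s <= 1 by rewrite invf_le1 // lerDl sqdot_ge0.
  by nra.
have := inner_kernel_form_ball m hp swB.
rewrite kernel_formZ exprZn da_polyZ innerZr -rmorphXn.
have -> : ((s ^+ m)%:C)^* = (s ^+ m)%:C by exact: conjc_real.
have sm0 : (s ^+ m)%:C != 0 by rewrite fmorph_eq0 expf_neq0 // gt_eqF.
have [mn|_] := eqVneq m n => h; apply: (mulfI sm0); rewrite h ?mulr0 // mn.
rewrite rmorphXn -hp; apply: mpoly.meval_eq => j.
by rewrite mxE.
Qed.

Lemma coef1_XD_exp (c : R[i]) k : ((c%:P + 'X) ^+ k)`_1 = c ^+ k.-1 *+ k.
Proof.
have -> : ((c%:P + 'X) ^+ k)`_1 = ((c%:P + 'X) ^+ k)^`().[0].
  by rewrite horner_coef0 coef_deriv.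
rewrite deriv_exp derivD derivC derivX add0r mul1r.
by rewrite hornerMn horner_exp hornerD hornerC hornerX addr0.
Qed.

Section Polarization.
Variables (phi : mpol -> R[i]) (a : mnm).
Hypothesis phiP : forall c p q, phi (c *: p + q) = c * phi p + phi q.
Definition linear_form (v : 'I_d -> R[i]) : mpol := \sum_j v j *: coordX R j.
Hypothesis phi_linear_form : forall m v,
  phi (linear_form v ^+ m) = if m == mpoly.mdeg a then \prod_i v i ^+ a i else 0.

Let phi0 : phi 0 = 0.
Proof.
apply: (@addrI _ (phi 0)); rewrite addr0.
by have := phiP 1 0 0; rewrite scaler0 addr0 mul1r => <-.
Qed.
Let phiD p q : phi (p + q) = phi p + phi q.
Proof. by have := phiP 1 p q; rewrite scale1r mul1r. Qed.
Let phiZ c p : phi (c *: p) = c * phi p.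
Proof. by have := phiP c p 0; rewrite !addr0 phi0 addr0. Qed.

Let phiMn p n : phi (p *+ n) = phi p *+ n.
Proof. by elim: n => [|n IHn]; rewrite ?mulr0n // !mulrS phiD IHn. Qed.

(** A functional on polynomials known on powers of linear forms is known on
    monomials: both sides of the formula for [m + 1] and [b] are polynomials in
    [t] when [v] moves to [v + t e_j], and their coefficients of [t] give the
    formula for [m] and [b + e_j].  At [m = 0] only the monomial is left.  The
    falling factorials are the derivatives of the monomial [a], and vanish when
    [b] does not divide [a]. *)
Lemma polarization (b : mnm) m v :
  phi (mpoly.mpolyX R[i] b * linear_form v ^+ m) * (m + mpoly.mdeg b)`!%:R =
  if (m + mpoly.mdeg b)%N == mpoly.mdeg a then
    m`!%:R * \prod_i ((a i ^_ b i)%:R * v i ^+ (a i - b i)) else 0.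
Proof.
elim: {b}(mpoly.mdeg b) {-2}b (erefl (mpoly.mdeg b)) m v => [|n IHn] b bn m v.
  have -> : b = mpoly.mnm0 by apply/eqP; rewrite -mpoly.mdeg_eq0 bn.
  rewrite mpoly.mpolyX0 mul1r mpoly.mdeg0 addn0 phi_linear_form; case: eqP => _; rewrite ?mul0r //.
  rewrite mulrC; congr (_ * _); apply: eq_bigr => i _.
  by rewrite mpoly.mnm0E ffactn0 mul1r subn0.
have [j bj] : exists j, b j != 0%N.
  apply: contrapT => b0; move: bn; rewrite mpoly.mdegE big1 // => i _.
  by apply/eqP/negPn/negP => bi; apply: b0; exists i.
pose b' := mpoly.mnm_sub b (mpoly.mnm1 j).
have bE : b = mpoly.mnm_add b' (mpoly.mnm1 j).
  by rewrite /b' mpoly.submK // mpoly.lep1mP.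
have b'n : mpoly.mdeg b' = n.
  by have := bn; rewrite bE mpoly.mdegD mpoly.mdeg1 addn1 => -[].
pose vt t := fun i => v i + t * (i == j)%:R.
have linvt t : linear_form (vt t) = linear_form v + t *: coordX R j.
  rewrite /linear_form (bigD1 j) //= [in RHS](bigD1 j) //= /vt eqxx mulr1 scalerDl.
  rewrite -!addrA; congr (_ + _); rewrite addrC; congr (_ + _).
  by apply: eq_bigr => i /negPf ->; rewrite mulr0 addr0.
pose X (b : mnm) := mpoly.mpolyX R[i] b.
(* [P] and [Q] are the two sides at [v + t e_j], as polynomials in [t]. *)
pose P : {poly R[i]} := \sum_(i < m.+2)
  ((phi (X b' * (linear_form v ^+ (m.+1 - i) * coordX R j ^+ i)) *+ 'C(m.+1, i)
    * (m.+1 + n)`!%:R) *: 'X^i).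
pose Q : {poly R[i]} := \prod_i
  ((a i ^_ b' i)%:R%:P * ((v i)%:P + (i == j)%:R *: 'X) ^+ (a i - b' i)).
have PE t : P.[t] = phi (X b' * linear_form (vt t) ^+ m.+1) * (m.+1 + n)`!%:R.
  rewrite /P horner_sum linvt exprDn mulr_sumr (big_morph phi phiD phi0) mulr_suml.
  apply: eq_bigr => i _; rewrite hornerZ hornerXn exprZn -scalerAr.
  rewrite (mulrnAr (X b')) phiMn -scalerAr phiZ.
  rewrite -mulrnAr; move: (phi _ *+ _) => u; rewrite mulrC.
  exact: mulrA.
have QE t : Q.[t] = \prod_i ((a i ^_ b' i)%:R * vt t i ^+ (a i - b' i)).
  rewrite /Q horner_prod; apply: eq_bigr => i _.
  by rewrite hornerM hornerC horner_exp hornerD hornerC hornerZ hornerX /vt [t * _]mulrC.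
pose k := if (m.+1 + n)%N == mpoly.mdeg a then m.+1`!%:R else 0 : R[i].
have PQ : P = k *: Q.
  apply: eq_poly_horner => t; rewrite hornerZ PE QE -b'n IHn // b'n /k.
  by case: eqP => _; rewrite ?mul0r.
have P1 : P`_1 = phi (X b * linear_form v ^+ m) *+ m.+1 * (m.+1 + n)`!%:R.
  rewrite /P coef_sum (bigD1 (inord 1)) //= big1; last first.
    move=> i; rewrite -val_eqE /= inordK // => /negPf i1.
    by rewrite coefZ coefXn eq_sym i1 mulr0.
  rewrite inordK // coefZ coefXn eqxx mulr1 addr0 bin1 subn1 expr1 /=.
  rewrite bE /X mpoly.mpolyXD -mulrA [coordX R j * _]mulrC //.
have Q1 : Q`_1 = \prod_i ((a i ^_ b i)%:R * v i ^+ (a i - b i)).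
  rewrite /Q (bigD1 j) //= [in RHS](bigD1 j) //= eqxx scale1r.
  rewrite (eq_bigr (fun i => ((a i ^_ b i)%:R * v i ^+ (a i - b i))%:P)).
    rewrite -rmorph_prod /= coefMC coefCM coef1_XD_exp.
    have -> : b j = (b' j).+1 by rewrite bE mpoly.mnmDE mpoly.mnm1E eqxx addn1.
    rewrite ffactnSr subnS natrM mulrC -mulr_natr; ring.
  move=> i ij; have -> : b i = b' i.
    by rewrite bE mpoly.mnmDE mpoly.mnm1E eq_sym (negPf ij) addn0.
  by rewrite (negPf ij) scale0r addr0 polyCM polyC_exp.
have := congr1 (fun p : {poly R[i]} => p`_1) PQ; rewrite coefZ P1 Q1.
rewrite bn addnS -addSn /k; case: eqP => _ h; last first.
  apply: (@mulfI _ m.+1%:R); first by rewrite pnatr_eq0.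
  by rewrite mulr0 mulrA mulr_natl h mul0r.
apply: (@mulfI _ m.+1%:R); first by rewrite pnatr_eq0.
by rewrite mulrA mulr_natl h factS natrM mulrA.
Qed.
End Polarization.

Local Notation mono a := (da_poly (mpoly.mpolyX R[i] a)).

(** The squared norm of the monomial [a], which is [a! / |a|!]. *)
Definition mweight (a : mnm) : R := (\prod_i (a i)`!)%:R / (mpoly.mdeg a)`!%:R.

Lemma mweight_gt0 a : 0 < mweight a.
Proof. by rewrite divr_gt0 // ltr0n ?fact_gt0 // prodn_gt0 // => i; rewrite fact_gt0. Qed.

Lemma mweight0 : mweight mpoly.mnm0 = 1.
Proof.
rewrite /mweight mpoly.mdeg0 fact0 divr1 big1 // => i _.
by rewrite mpoly.mnm0E fact0.
Qed.

Lemma mweightS (a : mnm) j :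
  mweight (mpoly.mnm_add a (mpoly.mnm1 j)) * (mpoly.mdeg a).+1%:R = mweight a * (a j).+1%:R.
Proof.
rewrite /mweight mpoly.mdegD mpoly.mdeg1 addn1 factS natrM.
have -> : (\prod_i (mpoly.mnm_add a (mpoly.mnm1 j) i)`!)%N = ((a j).+1 * \prod_i (a i)`!)%N.
  rewrite (bigD1 j) //= [in RHS](bigD1 j) //= mulnA -factS; congr (_ * _)%N.
    by rewrite mpoly.mnmDE mpoly.mnm1E eqxx addn1.
  by apply: eq_bigr => i ij; rewrite mpoly.mnmDE mpoly.mnm1E eq_sym (negPf ij) addn0.
have f0 : (mpoly.mdeg a)`!%:R != 0 :> R by rewrite pnatr_eq0 -lt0n fact_gt0.
have s0 : (mpoly.mdeg a).+1%:R != 0 :> R by rewrite pnatr_eq0.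
by rewrite natrM; field; rewrite f0 addrC -natr1 in s0 *.
Qed.

(** Pairing with the monomial [a] is a functional on polynomials whose values on
    powers of linear forms are those of [inner_kernel_form].  When [a] and [b]
    have the same degree but differ, some exponent of [b] exceeds that of [a]
    and the falling factorial vanishes. *)
Lemma mono_ortho (b a : mnm) :
  '[mono b, mono a] = if b == a then (mweight a)%:C else 0.
Proof.
pose phi p := '[da_poly p, mono a].
have phiP c p q : phi (c *: p + q) = c * phi p + phi q.
  by rewrite /phi da_polyD da_polyZ innerDl innerZl.
have phil m v : phi (linear_form v ^+ m) = if m == mpoly.mdeg a then \prod_i v i ^+ a i else 0.
  pose w : 'rV[R[i]]_d := \row_j (v j)^*.
  have -> : linear_form v = kernel_form w.
    by apply: eq_bigr => j _; rewrite mxE conjCK.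
  rewrite /phi innerC (inner_kernel_form _ _ (homogeneous_mX a)).
  case: eqP => _; rewrite ?conjC0 //.
  rewrite meval_mX rmorph_prod; apply: eq_bigr => i _.
  by rewrite rmorphXn /= mxE conjCK.
have := polarization phiP phil b 0 (fun _ => 0).
rewrite expr0 mulr1 add0n fact0 mul1r -/(phi _) => h.
have f0 : (mpoly.mdeg b)`!%:R != 0 :> R[i] by rewrite pnatr_eq0 -lt0n fact_gt0.
apply: (mulIf f0); rewrite -/(phi _) h; case: eqP => [ba|/eqP ba]; last first.
  case: eqP => [E|_]; rewrite ?mul0r //.
  by rewrite E eqxx in ba.
case: eqP => [E|nE].
  rewrite E /mweight rmorphM fmorphV !rmorph_nat /= divfK; last by rewrite -E.
  rewrite natr_prod; apply: eq_bigr => i _.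
  by rewrite subnn expr0 mulr1 ffactnn.
rewrite mul0r.
have [i ai] : exists i, (a i < b i)%N.
  apply: contrapT => hn; apply: nE.
  have le i : (b i <= a i)%N by rewrite leqNgt; apply/negP => ai; apply: hn; exists i.
  have bE : a = mpoly.mnm_add (mpoly.mnm_sub a b) b.
    by rewrite mpoly.submK //; apply/mpoly.mnm_lepP.
  have : mpoly.mdeg (mpoly.mnm_sub a b) == 0%N.
    by rewrite -(eqn_add2r (mpoly.mdeg b)) -mpoly.mdegD -bE add0n ba.
  by rewrite mpoly.mdeg_eq0 => /eqP ab; rewrite bE ab mpoly.add0m.
by rewrite (bigD1 i) //= ffact_small // mul0r mul0r.
Qed.

(** A vector orthogonal to the polynomials has the same inner product with the
    kernel function at [w] as with each remainder of its expansion, and these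
    remainders have squared norms [|w|^2n / (1 - |w|^2)], which tend to 0. *)
Lemma mono_total f : (forall a, '[f, mono a] = 0) -> f = 0.
Proof.
move=> fa.
have fp p : '[f, da_poly p] = 0.
  rewrite [p]mpoly.mpolyE.
  elim/big_ind: _ => [|q r hq hr|a _]; first by rewrite -(scale0r 0) da_polyZ scale0r inner0r.
    by rewrite da_polyD innerDr hq hr addr0.
  by rewrite da_polyZ innerZr fa mulr0.
apply: da_inner_ext => w wB; rewrite inner0l.
set S := sqdot w; have S1 : S < 1 by rewrite /S -unit_ballE.
have S0 : 0 <= S := sqdot_ge0 w.
pose r n := act (kernel_form w ^+ n) (K w).
have rn n : sqnorm (r n) = S ^+ n * (1 - S)^-1.
  apply: complexI; rewrite -sqnormE.
  have -> : '[r n, r n] = '[K w, r n] - '[\sum_(m < n) da_poly (kernel_form w ^+ m), r n].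
    by rewrite -innerBl {1}(kernel_expansion n wB) addrAC subrr add0r.
  rewrite inner_suml big1 ?subr0; last first.
    move=> m _.
    have -> : r n = K w - \sum_(m < n) da_poly (kernel_form w ^+ m).
      by rewrite {1}(kernel_expansion n wB) addrAC subrr add0r.
    rewrite innerBr da_poly_kernel // inner_sumr.
    under eq_bigr => l _ do rewrite (inner_kernel_form _ _ (homogeneous_kernel_form m w)).
    rewrite (bigD1 m) //= eqxx big1 ?addr0 ?subrr // => l.
    by rewrite -val_eqE => /negPf /= ->.
  (* What is left is the conjugate of the value at [w] of the remainder. *)
  rewrite innerC /r act_kernel // rmorphXn /= meval_kernel_form -da_evalE // da_kernelE //.
  rewrite sqdotE -/S rmorphM rmorphXn fmorphV rmorphB /=.
  have -> : (S%:C)^* = S%:C by exact: conjc_real.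
  by rewrite conjC1 rmorphM rmorphXn fmorphV rmorphB rmorph1.
have fr n : '[f, K w] = '[f, r n].
  by rewrite {1}(kernel_expansion n wB) innerDr inner_sumr big1 ?add0r.
pose q : R := complex.Re (`|'[f, K w]| ^+ 2).
have qE : q%:C = `|'[f, K w]| ^+ 2 by rewrite RRe_real // ger0_real // exprn_ge0.
pose Cst := sqnorm f * (1 - S)^-1.
have hq n : q <= Cst * S ^+ n.
  rewrite -lecR qE (fr n) (le_trans (sqr_inner_le _ _)) // rn lecR /Cst.
  by rewrite -mulrA [S ^+ n * _]mulrC.
have cv : (fun n => Cst * S ^+ n) @ \oo --> (0 : R).
  rewrite -[X in _ --> X](mulr0 Cst); apply: cvgM; first exact: cvg_cst.
  by apply: cvg_expr; rewrite ger0_norm.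
have q0 : q <= 0.
  rewrite leNgt; apply/negP => /(cvg_near0 cv)[N /(_ N (leqnn _))].
  by rewrite ltNge hq.
apply/eqP; rewrite -normr_eq0 -sqrf_eq0 -qE (_ : q = 0) //.
by apply/eqP; rewrite eq_le q0 -lecR qE exprn_ge0.
Qed.

End Kernel.

(** * Taylor coefficients of vectors of a free module *)

Section FreeModuleCoefficients.
Variables (R : realType) (d : nat) (H2 : druryArveson R d).
Variables (C : hilbertType R) (F : freeModule H2 C).
Local Notation mnm := (mpoly.multinom d).
Implicit Types (a b : mnm) (c eta : C) (x : F).

Local Notation "a +U j" := (mpoly.mnm_add a (mpoly.mnm1 j)) (at level 50).

Lemma free_act_bounded p : exists M : R, forall x : F, sqnorm (act p x) <= M * sqnorm x.
Proof.
have /cvgrPdist_lt := @free_act_continuous _ _ _ _ F p 0.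
move=> /(_ 1 ltr01); rewrite linear0 => /nbhs_ballP[e /= e0 he].
pose r := complex.Re e.
have eE : e = r%:C by rewrite RRe_real // gtr0_real.
have r0 : 0 < r by rewrite -ltcR -eE.
exists ((2 / r) ^+ 2) => x.
have [->|x0] := eqVneq x 0; first by rewrite linear0 {2}/sqnorm inner0l mulr0 /sqnorm inner0l.
have nx0 : 0 < `|x| by rewrite normr_gt0.
pose t := (r / 2)%:C / `|x|.
have r2 : 0 < (r / 2)%:C :> R[i] by rewrite ltcR divr_gt0.
have t0 : 0 < t by rewrite divr_gt0.
have : `|0 - act p (t *: x)| < 1.
  apply: he; rewrite -ball_normE /= sub0r normrN normrZ gtr0_norm //.
  rewrite divfK ?gt_eqF // eE ltcR ltr_pdivrMr // mulr_natr mulr2n ltrDl //.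
rewrite sub0r normrN linearZ normrZ gtr0_norm // => h.
have q0 : 0 <= (2 / r)%:C by rewrite ler0c divr_ge0 // ltW.
rewrite -lecR (_ : (_ * sqnorm x)%:C = ((2 / r)%:C * `|x|) ^+ 2); last first.
  by rewrite [in RHS]exprMn norm_sqnorm rmorphM rmorphXn.
rewrite -norm_sqnorm ler_sqr ?nnegrE ?mulr_ge0 //.
rewrite -(ler_pM2l t0) (le_trans (ltW h)) // mulrCA /t divfK ?gt_eqF //.
rewrite -rmorphM (_ : 2 / r * (r / 2) = 1) //.
by field; rewrite gt_eqF.
Qed.

Lemma sqnorm_tens f c : sqnorm (tens F f c) = sqnorm f * sqnorm c.
Proof. by apply: complexI; rewrite rmorphM /= -!sqnormE tens_inner. Qed.

(** Any nonzero vector [c] embeds [H2] in the free module, up to a factor, by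
    [f |-> f (x) c]. *)
Lemma da_act_bounded c : c != 0 -> da_bounded H2.
Proof.
move=> c0 p; have [M hM] := free_act_bounded p; exists M => f.
have sc : 0 < sqnorm c.
  by rewrite lt_def sqnorm_ge0 andbT; apply: contra_neq c0; exact: sqnorm_eq0.
by rewrite -(ler_pM2r sc) -mulrA -!sqnorm_tens -free_act hM.
Qed.

Lemma orthogonal_tens_eq0 x : (forall f c, '[x, tens F f c] = 0) -> x = 0.
Proof.
move=> h; apply/eqP/negPn/negP => x0.
have nx0 : 0 < `|x| by rewrite normr_gt0.
have [||y [yx [s ys]]] := @tens_dense _ _ _ _ F (ball x `|x|).
- by exists x; apply: ballxx.
- exact: ball_open.
rewrite -ball_normE /= in yx.
have xy : '[x, y] = 0 by rewrite ys inner_sumr big1.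
have : `|x - y| ^+ 2 < `|x| ^+ 2 by rewrite ltr_sqr ?nnegrE.
rewrite !norm_sqnorm ltcR sqnormB xy mulr0 subr0.
by rewrite gtrDl ltNge sqnorm_ge0.
Qed.

Lemma free_eq0 : (forall c, c = 0) -> forall x, x = 0.
Proof.
move=> h x; apply: orthogonal_tens_eq0 => f c.
by rewrite (h c) linear0 inner0r.
Qed.

Definition monomial a eta : F := tens F (da_poly H2 (mpoly.mpolyX R[i] a)) eta.

Lemma act_monomial j a eta : act (coordX R j) (monomial a eta) = monomial (a +U j) eta.
Proof.
rewrite /monomial free_act; congr (tens F _ _).
by rewrite /da_poly -actM /coordX -mpoly.mpolyXD mpoly.addmC.
Qed.

Lemma act1 (H : hilbertModType R d) (h : H) : act 1 h = h.
Proof. by have := actC 1 h; rewrite scale1r. Qed.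

Lemma monomial0 eta : monomial mpoly.mnm0 eta = tens F (da_one H2) eta.
Proof. by rewrite /monomial mpoly.mpolyX0 /da_poly act1. Qed.

Hypothesis act_bounded : da_bounded H2.

Local Notation mw := (@mweight R d).

Lemma monomial_ortho b a c eta :
  '[monomial b c, monomial a eta] = if b == a then (mw a)%:C * '[c, eta] else 0.
Proof. by rewrite tens_inner mono_ortho //; case: eqP => _; rewrite ?mul0r. Qed.

(** The vector of [H2] that represents [f |-> <f (x) c, x>] is orthogonal to the
    polynomials. *)
Lemma monomial_total x : (forall a eta, '[x, monomial a eta] = 0) -> x = 0.
Proof.
move=> h; apply: orthogonal_tens_eq0 => f c.
pose psi (g : H2) := '[tens F g c, x].
have [||g hg] := @riesz _ _ psi (sqnorm c * sqnorm x).
- by move=> a y z; rewrite /psi linearPl innerDl innerZl.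
- move=> g; rewrite (le_trans (sqr_inner_le _ _)) // sqnorm_tens lecR.
  by rewrite mulrC [_ * sqnorm c]mulrC mulrA [sqnorm x * _]mulrC.
have g0 : g = 0.
  by apply: (mono_total act_bounded) => a; rewrite innerC -hg /psi innerC h !conjC0.
by rewrite innerC -/(psi f) hg g0 inner0r conjC0.
Qed.

(** Identities between bounded functionals need only be checked on monomials. *)
Lemma functional_ext (psi : F -> R[i]) (M : R) :
  (forall k x y, psi (k *: x + y) = k * psi x + psi y) ->
  (forall x, `|psi x| ^+ 2 <= (M * sqnorm x)%:C) ->
  (forall a eta, psi (monomial a eta) = 0) -> forall x, psi x = 0.
Proof.
move=> psiP psiM psi0 x; have [z hz] := riesz psiP psiM.
have -> : psi x = '[x, z] by [].
suff -> : z = 0 by rewrite inner0r.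
by apply: monomial_total => a eta; rewrite innerC -hz psi0 conjC0.
Qed.

(** The weight makes [c] the coefficient of the monomial [a] in the power series
    of [x], rather than its inner product with that monomial. *)
Definition is_taylor x a c := forall eta, (mw a)%:C * '[c, eta] = '[x, monomial a eta].

Lemma mw_neq0 a : (mw a)%:C != 0 :> R[i].
Proof. by rewrite fmorph_eq0 gt_eqF // mweight_gt0. Qed.

Lemma taylor_exists x a : exists c, is_taylor x a c.
Proof.
pose psi eta := (mw a)%:C^-1 * '[monomial a eta, x].
have [||c hc] := @riesz _ _ psi ((mw a)^-1 * sqnorm x).
- move=> k y z; rewrite /psi /monomial linearPr innerDl innerZl; ring.
- move=> eta; rewrite /psi normrM exprMn -fmorphV.
  have h0 : 0 <= (mw a)^-1 by rewrite invr_ge0 ltW // mweight_gt0.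
  rewrite ger0_norm ?ler0c //.
  have h1 := sqr_inner_le (monomial a eta) x.
  rewrite (le_trans (ler_wpM2l _ h1)) ?exprn_ge0 ?ler0c //.
  rewrite -rmorphXn -rmorphM lecR sqnorm_tens.
  have -> : sqnorm (da_poly H2 (mpoly.mpolyX R[i] a)) = mw a.
    by apply: complexI; rewrite -sqnormE mono_ortho // eqxx.
  rewrite le_eqVlt; apply/orP; left; apply/eqP.
  have m0 : mw a != 0 by rewrite gt_eqF // mweight_gt0.
  by field.
have kJ : ((mw a)%:C^-1)^* = (mw a)%:C^-1 by rewrite -fmorphV; exact: conjc_real.
have cM (p q : R[i]) : (p * q)^* = p^* * q^* by rewrite rmorphM.
exists c => eta; rewrite innerC -hc /psi cM kJ -innerC.
by rewrite mulrA mulfV ?mul1r // mw_neq0.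
Qed.

Definition taylor x : mnm -> C := fun a => xget 0 (is_taylor x a).

Lemma taylorP x a : is_taylor x a (taylor x a).
Proof. by apply: xgetPex; apply: taylor_exists. Qed.

Lemma taylor_unique x a c : is_taylor x a c -> taylor x a = c.
Proof.
move=> hc; apply: inner_inj => eta; apply: (mulfI (mw_neq0 a)).
by rewrite hc taylorP.
Qed.

Lemma taylor_linear k x y a : taylor (k *: x + y) a = k *: taylor x a + taylor y a.
Proof.
apply: taylor_unique => eta; rewrite !innerDl !innerZl mulrDr mulrCA.
by rewrite !taylorP.
Qed.

Lemma taylor_eq0 x : (forall a, taylor x a = 0) -> x = 0.
Proof.
by move=> h; apply: monomial_total => a eta; rewrite -taylorP h inner0l mulr0.
Qed.

Lemma taylor_value0 x : taylor x mpoly.mnm0 = value_at x 0.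
Proof.
apply: is_value_unique (value_atP x 0) => eta.
by rewrite -[tens _ _ _]monomial0 -taylorP mweight0 mul1r.
Qed.

Lemma taylor_shift0 j x a : a j = 0%N -> taylor (act (coordX R j) x) a = 0.
Proof.
move=> aj; apply: taylor_unique => eta; rewrite inner0l mulr0; apply/esym.
have [M hM] := free_act_bounded (coordX R j).
apply: (@functional_ext (fun x => '[act (coordX R j) x, monomial a eta])
  (M * sqnorm (monomial a eta))).
- by move=> k y z; rewrite linearP innerDl innerZl.
- move=> y; rewrite (le_trans (sqr_inner_le _ _)) // lecR mulrAC.
  by rewrite ler_wpM2r ?sqnorm_ge0.
move=> b c; rewrite act_monomial monomial_ortho; case: eqP => // E.
by move: aj; rewrite -E mpoly.mnmDE mpoly.mnm1E eqxx addn1.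
Qed.

(** By [functional_ext] this is a comparison of the norms of the monomials [b]
    and [b + e_j]. *)
Lemma taylor_shift j x b : taylor (act (coordX R j) x) (b +U j) = taylor x b.
Proof.
apply: taylor_unique => eta.
pose r := mw (b +U j) / mw b.
have rE : r * mw b = mw (b +U j) by rewrite /r divfK // gt_eqF // mweight_gt0.
have [M hM] := free_act_bounded (coordX R j).
pose psi y := '[act (coordX R j) y, monomial (b +U j) eta] - r%:C * '[y, monomial b eta].
suff h : psi x = 0.
  move/eqP: h; rewrite subr_eq0 => /eqP ->.
  by rewrite -taylorP mulrA -rmorphM rE.
apply: (@functional_ext psi
  (2 * (M * sqnorm (monomial (b +U j) eta) + r ^+ 2 * sqnorm (monomial b eta)))).
- by move=> k y z; rewrite /psi linearP !innerDl !innerZl; ring.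
- move=> y; rewrite (le_trans (sqr_normcD _ _)) //.
  set A := M * _; set B := r ^+ 2 * _.
  have -> : (2 * (A + B) * sqnorm y)%:C = 2 * ((A * sqnorm y)%:C + (B * sqnorm y)%:C).
    rewrite -rmorphD -mulrDl -(rmorph_nat (real_complex R) 2) -rmorphM.
    by rewrite mulrA.
  rewrite ler_wpM2l // lerD //.
    rewrite (le_trans (sqr_inner_le _ _)) // lecR /A mulrAC.
    by rewrite ler_wpM2r ?sqnorm_ge0.
  rewrite normrN normrM exprMn.
  have r0 : 0 <= r by rewrite divr_ge0 // ltW // mweight_gt0.
  rewrite (@ger0_norm _ r%:C) ?ler0c //.
  have -> : (B * sqnorm y)%:C = r%:C ^+ 2 * (sqnorm y * sqnorm (monomial b eta))%:C.
    by rewrite -rmorphXn -rmorphM /B -mulrA [sqnorm y * _]mulrC.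
  by rewrite ler_wpM2l ?sqr_inner_le // exprn_ge0 // ler0c.
move=> a c; rewrite /psi act_monomial !monomial_ortho mpoly.eqm_add2r.
case: eqP => _; last by rewrite mulr0 subrr.
by rewrite mulrA -rmorphM rE subrr.
Qed.

Lemma bessel x (s : seq mnm) : uniq s ->
  \sum_(a <- s) mw a * sqnorm (taylor x a) <= sqnorm x.
Proof.
move=> us; pose y := \sum_(a <- s) monomial a (taylor x a).
pose B := \sum_(a <- s) mw a * sqnorm (taylor x a).
have BE : B%:C = \sum_(a <- s) (mw a)%:C * '[taylor x a, taylor x a].
  by rewrite rmorph_sum; apply: eq_bigr => a _; rewrite sqnormE rmorphM.
have xy : '[x, y] = B%:C.
  by rewrite inner_sumr BE; apply: eq_bigr => a _; rewrite taylorP.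
have yy : '[y, y] = B%:C.
  rewrite {1}/y inner_suml BE; apply: eq_big_seq => a sa.
  rewrite /y inner_sumr (bigD1_seq a) //= monomial_ortho eqxx big1 ?addr0 // => b ba.
  by rewrite monomial_ortho eq_sym (negPf ba).
have := sqnorm_ge0 (x - y); rewrite sqnormB {2}/sqnorm xy yy /= -/B.
by set b := B; lra.
Qed.

(** Multi-indices are enumerated by [pickle]; numbers that do not encode one
    contribute zero terms. *)
Lemma riesz_fischer (g : mnm -> C) (B : R) :
  (forall s : seq mnm, uniq s -> \sum_(a <- s) mw a * sqnorm (g a) <= B) ->
  exists x, forall a, taylor x a = g a.
Proof.
move=> gB.
pose u n := if @pickle_inv mnm n is Some a then monomial a (g a) else 0.
have uo m n : m != n -> '[u m, u n] = 0.
  rewrite /u; case E1: pickle_inv => [a|]; case E2: pickle_inv => [b|] mn;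
    rewrite ?inner0l ?inner0r //.
  rewrite monomial_ortho; case: eqP => // ab.
  have := @pickle_invK mnm m; have := @pickle_invK mnm n; rewrite E1 E2 /= => h1 h2.
  by move: mn; rewrite -h1 -h2 ab eqxx.
have sqm a c : sqnorm (monomial a c) = mw a * sqnorm c.
  by apply: complexI; rewrite -sqnormE monomial_ortho eqxx sqnormE -rmorphM.
have [|x ux] := orthogonal_series (B := B) uo.
  move=> N; rewrite (le_trans _ (gB (pmap (@pickle_inv mnm) (index_iota 0 N)) _)) //; last first.
    by apply: (pmap_uniq (@pickle_invK mnm)); exact: iota_uniq.
  elim: (index_iota 0 N) => [|n s IHs]; first by rewrite !big_nil.
  rewrite big_cons /= {1}/u; case: pickle_inv => [a|] /=.
    by rewrite big_cons sqm lerD2l.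
  by rewrite {1}/sqnorm inner0l add0r.
exists x => a; apply: taylor_unique => eta; apply/esym.
pose l := (mw a)%:C * '[g a, eta].
pose K := complex.Re (`|l| ^+ 2).
have KE : K%:C = `|l| ^+ 2 by rewrite RRe_real // ger0_real // exprn_ge0.
have K0 : 0 <= K by rewrite -ler0c KE exprn_ge0.
pose e n : R := if (pickle a < n)%N then 0 else K.
have e0 : e @ \oo --> 0.
  apply: near0_cvg => [n|r r0]; first by rewrite /e; case: ifP.
  by exists (pickle a).+1 => n hn; rewrite /e hn.
apply: (norm_cvg_inner ux e0) => n; rewrite inner_suml.
have other m : m != pickle a -> '[u m, monomial a eta] = 0.
  rewrite /u; case E: pickle_inv => [b|] mn; rewrite ?inner0l //.
  rewrite monomial_ortho; case: eqP => // ba.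
  by have := @pickle_invK mnm m; rewrite E /= ba => h; rewrite h eqxx in mn.
rewrite /e; case: ifP => [an|an].
  rewrite (bigD1_seq (pickle a)) ?mem_index_iota ?iota_uniq //= big1 ?addr0; last first.
    by move=> m /other.
  by rewrite /u pickleK_inv monomial_ortho eqxx subrr normr0 expr0n.
rewrite big_nat big1 ?sub0r ?normrN ?KE // => m /andP[_ mn].
by apply: other; apply: contraFneq an => <-.
Qed.

(** This is the derivative in [z_j] of the series divided, in degree [n], by
    [n + k].  The weights make it a contraction: the coefficient at [b] is
    multiplied by [(b_j + 1) / (|b| + 1 + k)], while the ratio of the weights of
    [b + e_j] and [b] is [(b_j + 1) / (|b| + 1)], and [b_j <= |b|]. *)
Lemma deriv_exists x j (k : nat) : exists y, forall b,
  taylor y b = ((b j).+1%:R / ((mpoly.mdeg b).+1 + k)%:R) *: taylor x (b +U j).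
Proof.
apply: (@riesz_fischer _ (sqnorm x)) => s us.
have us' : uniq [seq b +U j | b <- s].
  by rewrite map_inj_uniq // => a b /eqP; rewrite mpoly.eqm_add2r => /eqP.
rewrite (le_trans _ (bessel x us')) // big_map; apply: ler_sum => b _.
have -> : sqnorm (((b j).+1%:R / ((mpoly.mdeg b).+1 + k)%:R) *: taylor x (b +U j)) =
   ((b j).+1%:R / ((mpoly.mdeg b).+1 + k)%:R) ^+ 2 * sqnorm (taylor x (b +U j)).
  apply: complexI; rewrite sqnormZ rmorphM rmorphXn rmorphM fmorphV !rmorph_nat.
  by rewrite ger0_norm // divr_ge0.
rewrite mulrA ler_wpM2r ?sqnorm_ge0 //.
have D0 : 0 < (mpoly.mdeg b).+1%:R :> R by rewrite ltr0n.
rewrite -(ler_pM2r D0) mweightS -mulrA ler_wpM2l ?(ltW (mweight_gt0 _ _)) //.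
rewrite expr_div_n mulrAC ler_pdivrMr ?exprn_gt0 ?ltr0n // expr2 -mulrA.
rewrite ler_wpM2l // -natrX -!natrM ler_nat expnS expn1.
rewrite leq_mul ?leq_addr // (leq_trans _ (leq_addr _ _)) // ltnS.
by rewrite mpoly.mdegE (bigD1 j) //= leq_addr.
Qed.

End FreeModuleCoefficients.

(** * The Koszul differential and its homotopy *)

Section AbstractKoszul.
Variables (K : numFieldType) (d : nat) (V : lmodType K).
Variables (X D : 'I_d -> {linear V -> V}).
Implicit Types (w : {set 'I_d} -> V) (S T : {set 'I_d}) (i j : 'I_d).

Definition below i S := #|[set j in S | (j < i)%N]|%SET.
Definition ksign i S : K := (-1) ^+ below i S.

(** Forms of all degrees at once are functions on sets of indices: [w S] is the
    coefficient of the exterior product of the [e_i] for [i] in [S]. *)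
Definition boundary w T := \sum_(i | i \notin T) ksign i T *: X i (w (i |: T)%SET).

(** The operator [h] of the Poincare lemma: derive in [z_j] and multiply by [e_j]. *)
Definition coboundary w S := \sum_(j in S) ksign j S *: D j (w (S :\ j)%SET).

Lemma below_add i j S : j \notin S -> below i (j |: S)%SET = (below i S + (j < i))%N.
Proof.
move=> jS; rewrite /below addnC; case: ltnP => ji.
  rewrite -(_ : j |: [set k in S | (k < i)%N] = [set k in j |: S | (k < i)%N])%SET.
    by rewrite cardsU1 inE (negPf jS).
  by apply/setP => k; rewrite !inE; case: eqP => [->|] //=; rewrite ji.
rewrite add0n; apply: eq_card => k; rewrite !inE.
by case: eqP => [->|] //=; rewrite ltnNge ji andbF.
Qed.

Lemma below_rem i j S : j \in S -> below i S = (below i (S :\ j)%SET + (j < i))%N.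
Proof.
by move=> jS; rewrite -{1}(finset.setD1K jS) below_add // !inE eqxx.
Qed.

Lemma ksign2 i S : ksign i S * ksign i S = 1.
Proof. by rewrite /ksign -expr2 sqrr_sign. Qed.

Lemma ksignU1 i S : i \notin S -> ksign i (i |: S)%SET = ksign i S.
Proof. by move=> iS; rewrite /ksign below_add // ltnn addn0. Qed.

Lemma ksignD1 i S : i \in S -> ksign i (S :\ i)%SET = ksign i S.
Proof. by move=> iS; rewrite /ksign [in RHS](below_rem _ iS) ltnn addn0. Qed.

Lemma sign_ltn i j : i != j -> (-1) ^+ (i < j)%N = - (-1) ^+ (j < i)%N :> K.
Proof. by rewrite -val_eqE /=; case: ltngtP => // _ _; rewrite ?opprK. Qed.

Hypothesis XC : forall i j v, X i (X j v) = X j (X i v).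

(** Exchanging the two removed indices changes the sign of a term. *)
Lemma boundary_boundary w T : boundary (boundary w) T = 0.
Proof.
pose A i j := (ksign i T * ksign j (i |: T)%SET) *: X i (X j (w (j |: (i |: T))%SET)).
have E : boundary (boundary w) T = \sum_(i | i \notin T) \sum_(j | (j \notin T) && (j != i)) A i j.
  apply: eq_bigr => i iT; rewrite linear_sum scaler_sumr.
  apply: eq_big => [j|j _]; first by rewrite !inE negb_or andbC.
  by rewrite linearZ scalerA.
have AN i j : i \notin T -> j \notin T -> j != i -> A j i = - A i j.
  move=> iT jT ji; rewrite /A finset.setUCA XC -scaleNr; congr (_ *: _).
  rewrite /ksign !below_add // !exprD.
  by rewrite (sign_ltn ji); ring.
have S2 : boundary (boundary w) T = - boundary (boundary w) T.
  rewrite {1}E (exchange_big_dep (fun j => j \notin T)) /=; last by move=> i j _ /andP[].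
  rewrite E -sumrN; apply: eq_bigr => j jT; rewrite -sumrN.
  apply: eq_big => [i|i]; first by rewrite jT /= eq_sym.
  by move=> /andP[iT /andP[_ ji]]; apply: AN => //; rewrite eq_sym.
apply/eqP; have : boundary (boundary w) T *+ 2 = 0 by rewrite mulr2n {1}S2 addNr.
by rewrite -scaler_nat => /eqP; rewrite scaler_eq0 pnatr_eq0.
Qed.

Hypothesis DX : forall i j v, D j (X i v) = X i (D j v) + (if i == j then v else 0).

(** Removing an index [i] and adding another index [j] contribute opposite terms
    to the two compositions.  The terms with [i = j] are [X_i D_i] for [i] outside
    [S] and [D_i X_i = X_i D_i + 1] for [i] in [S].  When the [X_i D_i] are the
    [z_i d/dz_i], their sum multiplies a series by its degree, by the identity of
    Euler. *)
Lemma boundary_euler w S :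
  boundary (coboundary w) S + coboundary (boundary w) S = \sum_i X i (D i (w S)) + w S *+ #|S|.
Proof.
pose A i j := (ksign i S * ksign j (i |: S)%SET) *: X i (D j (w ((i |: S) :\ j)%SET)).
have E1 : boundary (coboundary w) S = \sum_(i | i \notin S) (X i (D i (w S)) + \sum_(j in S) A i j).
  apply: eq_bigr => i iS; rewrite linear_sum scaler_sumr big_setU1 //=; congr (_ + _).
    by rewrite linearZ scalerA ksignU1 // ksign2 scale1r finset.setU1K.
  by apply: eq_bigr => j jS; rewrite linearZ scalerA.
have E2 : coboundary (boundary w) S = \sum_(j in S) (D j (X j (w S)) - \sum_(i | i \notin S) A i j).
  apply: eq_bigr => j jS; rewrite linear_sum scaler_sumr (bigD1 j) /=; last first.
    by rewrite !inE eqxx.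
  rewrite linearZ scalerA ksignD1 // ksign2 scale1r finset.setD1K //; congr (_ + _).
  rewrite -sumrN; apply: eq_big => [i|i].
    rewrite !inE negb_and negbK; case: eqP => [->|] //=; last by rewrite andbT.
    by rewrite jS.
  rewrite !inE negb_and negbK => /andP[+ ij]; rewrite (negPf ij) /= => iS.
  have ji : j != i by rewrite eq_sym.
  rewrite linearZ scalerA DX (negPf ij) addr0 /A -scaleNr.
  have -> : (i |: S :\ j = (i |: S) :\ j)%SET.
    apply/setP => k; rewrite !inE; case: (eqVneq k j) => [->|] //=.
    by rewrite (negPf ji).
  congr (_ *: _); rewrite /ksign (below_rem i jS) below_add // !exprD.
  by rewrite (sign_ltn ij); case: (j < i)%N; rewrite ?expr0 ?expr1; ring.
rewrite E1 E2 big_split sumrB /= addrACA [X in _ + (X - _)]exchange_big subrr addr0.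
under [X in _ + X = _]eq_bigr => j _ do rewrite DX eqxx.
rewrite big_split /= sumr_const addrA; congr (_ + _).
by rewrite [RHS](bigID (mem S)) addrC.
Qed.

End AbstractKoszul.

Section KoszulComplex.
Variables (R : realType) (d : nat) (H : hilbertModType R d).

Definition mulX (j : 'I_d) : {linear H -> H} := act (coordX R j) : {linear H -> H}.

Lemma mulXC i j (x : H) : mulX i (mulX j x) = mulX j (mulX i x).
Proof. by rewrite /mulX /= -!actM mulrC. Qed.

(** Forms of a fixed degree are moved to functions on all sets of indices, where
    index types do not depend on the degree. *)
Definition extend k (w : koszul_space H k) (S : {set 'I_d}) : H :=
  if insub S is Some T then w T else 0.

Definition form_of k (f : {set 'I_d} -> H) : koszul_space H k := [ffun T => f (val T)].

Lemma extend_val k (w : koszul_space H k) T : extend w (val T) = w T.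
Proof. by rewrite /extend valK. Qed.

Lemma extend_supp k (w : koszul_space H k) (S : {set 'I_d}) : #|S| != k -> extend w S = 0.
Proof. by move=> Sk; rewrite /extend insubN. Qed.

Lemma extend_inj k (w w' : koszul_space H k) : extend w =1 extend w' -> w = w'.
Proof. by move=> h; apply/ffunP => T; rewrite -!extend_val h. Qed.

Lemma extend_form_of k f : (forall S : {set 'I_d}, #|S| != k -> f S = 0) ->
  extend (form_of k f) =1 f.
Proof.
move=> h S; rewrite /extend; case: insubP => [T _ <-|Sk]; first by rewrite ffunE.
by rewrite h.
Qed.

Lemma koszulE k (w : koszul_space H k.+1) T : koszul H k w T = boundary mulX (extend w) (val T).
Proof.
rewrite /koszul sum_ffunE.
under eq_bigr => S _ do (rewrite sum_ffunE; under eq_bigr => i _ do rewrite !ffunE).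
rewrite (exchange_big_dep xpredT) //= /boundary [RHS]big_mkcond; apply: eq_bigr => i _ /=.
case: ifPn => iT; last first.
  rewrite negbK in iT; apply: big1 => S iS; case: eqP => [E|_]; last by rewrite scaler0.
  by move: iT; rewrite E !inE eqxx.
have cS : #|(i |: val T)%SET| == k.+1 by rewrite cardsU1 iT (eqP (valP T)).
rewrite (bigD1 (Sub (i |: val T)%SET cS)) /=; last by rewrite !inE eqxx.
rewrite finset.setU1K // eqxx big1 ?addr0; last first.
  move=> S /andP[iS nS]; case: eqP => [E|_]; last by rewrite scaler0.
  case/negP: nS; apply/eqP/val_inj; rewrite /= E finset.setD1K //.
rewrite -/(below i _) -(ksignU1 _ iT) /ksign; congr (_ *: act _ _).
by rewrite -extend_val.
Qed.

Lemma boundary_supp k (f : {set 'I_d} -> H) :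
  (forall S : {set 'I_d}, #|S| != k.+1 -> f S = 0) ->
  forall S : {set 'I_d}, #|S| != k -> boundary mulX f S = 0.
Proof.
move=> h S Sk; apply: big1 => i iS; rewrite h ?linear0 ?scaler0 //.
by rewrite cardsU1 iS add1n eqSS.
Qed.

Lemma extend_koszul k (w : koszul_space H k.+1) : extend (koszul H k w) =1 boundary mulX (extend w).
Proof.
move=> S; rewrite {1}/extend; case: insubP => [T _ <-|Sk]; first exact: koszulE.
by rewrite (boundary_supp (@extend_supp _ w)).
Qed.

Lemma eq_boundary f g : f =1 g -> boundary mulX f =1 boundary mulX g.
Proof. by move=> fg S; apply: eq_bigr => i _; rewrite fg. Qed.

Lemma koszul_koszul k (w : koszul_space H k.+2) : koszul H k (koszul H k.+1 w) = 0.
Proof.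
apply: extend_inj => S; rewrite extend_koszul (eq_boundary (@extend_koszul _ w)).
rewrite boundary_boundary; last exact: mulXC.
by rewrite /extend; case: insub => // T; rewrite ffunE.
Qed.

End KoszulComplex.

Section FormalSeries.
Variables (R : realType) (d : nat) (C : hilbertType R).
Local Notation mnm := (mpoly.multinom d).
Local Notation "a +U j" := (mpoly.mnm_add a (mpoly.mnm1 j)) (at level 50).
Local Notation "a -U j" := (mpoly.mnm_sub a (mpoly.mnm1 j)) (at level 50).
Local Notation V := (mnm -> C).
Implicit Types (f g : V) (a b : mnm) (i j : 'I_d).

Definition series_mulX j f : V := fun a => if a j == 0%N then 0 else f (a -U j).
Definition series_deriv j f : V := fun a => (a j).+1%:R *: f (a +U j).

Fact series_mulX_is_linear j : linear (series_mulX j).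
Proof.
move=> k f g; apply/funext => a; rewrite /series_mulX /=.
by rewrite /GRing.add /GRing.scale /=; case: eqP => _; rewrite ?scaler0 ?addr0.
Qed.
HB.instance Definition _ j := GRing.isLinear.Build R[i] V V *:%R
  (series_mulX j) (series_mulX_is_linear j).

Fact series_deriv_is_linear j : linear (series_deriv j).
Proof.
move=> k f g; apply/funext => a; rewrite /series_deriv /=.
by rewrite [LHS]scalerDr !scalerA mulrC -scalerA.
Qed.
HB.instance Definition _ j := GRing.isLinear.Build R[i] V V *:%R
  (series_deriv j) (series_deriv_is_linear j).

Lemma mnmD1 a j i : (a +U j) i = (a i + (j == i))%N.
Proof. by rewrite mpoly.mnmDE mpoly.mnm1E. Qed.
Lemma mnmB1 a j i : (a -U j) i = (a i - (j == i))%N.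
Proof. by rewrite mpoly.mnmBE mpoly.mnm1E. Qed.
Lemma mnmDB a j : (a +U j) -U j = a.
Proof. by rewrite mpoly.addmK. Qed.
Lemma mnmBD a j : a j != 0%N -> (a -U j) +U j = a.
Proof. by move=> aj; rewrite mpoly.submK // mpoly.lep1mP. Qed.

Lemma series_deriv_mulX i j f :
  series_deriv j (series_mulX i f) = series_mulX i (series_deriv j f) + (if i == j then f else 0).
Proof.
apply/funext => a; rewrite -[RHS]/(_ a + _ a) /series_deriv /series_mulX.
have [->|ij] := eqVneq i j.
  rewrite mnmD1 eqxx addn1 /= mnmDB; have [a0|a0] := eqVneq (a j) 0%N.
    by rewrite a0 add0r scale1r.
  rewrite mnmB1 eqxx subn1 prednK ?lt0n // mnmBD // -natr1 scalerDl scale1r //.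
have ji : (j == i) = false by rewrite eq_sym (negPf ij).
rewrite mnmD1 ji addn0 -[X in _ + X]/0 addr0.
have [a0|a0] := eqVneq (a i) 0%N; first by rewrite scaler0.
rewrite mnmB1 (negPf ij) subn0; congr (_ *: f _).
apply/mpoly.mnmP => k; rewrite !(mnmB1, mnmD1).
have [<-|_] := eqVneq i k; last by rewrite !subn0.
by rewrite ji !addn0.
Qed.

Lemma series_mulX_deriv j f a : series_mulX j (series_deriv j f) a = (a j)%:R *: f a.
Proof.
rewrite /series_mulX /series_deriv; have [->|a0] := eqVneq (a j) 0%N; first by rewrite scale0r.
by rewrite mnmB1 eqxx subn1 prednK ?lt0n // mnmBD.
Qed.

End FormalSeries.

(** * Exactness of the Koszul complex of a free module *)

Section FreeKoszul.
Variables (R : realType) (d : nat) (H2 : druryArveson R d).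
Variables (C : hilbertType R) (F : freeModule H2 C).
Local Notation mnm := (mpoly.multinom d).
Implicit Types (S T : {set 'I_d}) (x y : F) (a : mnm).

Section Bounded.
Hypothesis act_bounded : da_bounded H2.

Let taylorl := @taylor_linear _ _ _ _ F act_bounded.

Lemma taylor0 : taylor (0 : F) = 0.
Proof.
apply/funext => a; apply: (taylor_unique act_bounded) => eta.
by rewrite !inner0l mulr0.
Qed.

Lemma taylorZ k x : taylor (k *: x) = k *: taylor x.
Proof. by apply/funext => a; rewrite -[k *: x]addr0 taylorl taylor0 addr0. Qed.

Lemma taylorD x y : taylor (x + y) = taylor x + taylor y.
Proof. by apply/funext => a; rewrite -[x in LHS]scale1r taylorl scale1r. Qed.

Lemma taylor_sum I (r : seq I) (P : pred I) (G : I -> F) :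
  taylor (\sum_(i <- r | P i) G i) = \sum_(i <- r | P i) taylor (G i).
Proof. exact: (big_morph _ taylorD taylor0). Qed.

Lemma taylor_inj x y : taylor x = taylor y -> x = y.
Proof.
move=> xy; apply/eqP; rewrite -subr_eq0; apply/eqP.
apply: (taylor_eq0 act_bounded) => a.
by rewrite taylorD -scaleN1r taylorZ scaleN1r xy subrr.
Qed.

Lemma taylor_mulX j x : taylor (mulX F j x) = series_mulX j (taylor x).
Proof.
apply/funext => a; rewrite /series_mulX; have [aj|aj] := eqVneq (a j) 0%N.
  exact: taylor_shift0.
by rewrite -{1}(mnmBD aj) taylor_shift.
Qed.

Lemma taylor_boundary (w : {set 'I_d} -> F) T :
  taylor (boundary (mulX F) w T) = boundary (@series_mulX R d C) (fun S => taylor (w S)) T.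
Proof.
by rewrite taylor_sum; apply: eq_bigr => i _; rewrite taylorZ taylor_mulX.
Qed.

Lemma sum_fctE I (r : seq I) (P : pred I) (G : I -> mnm -> C) a :
  (\sum_(i <- r | P i) G i) a = \sum_(i <- r | P i) G i a.
Proof. by elim/big_rec2: _ => // i y1 y2 _ <-. Qed.

(** The primitive is [coboundary b], where [b] divides the coefficients of degree
    [m] by [m + n]; it exists in the free module by [deriv_exists].  As [b] is
    again a cycle, [boundary_euler] says that the boundary of [coboundary b] is
    [b] multiplied back by [m + n].  The last hypothesis covers the only case in
    which [m + n = 0]. *)
Lemma boundary_primitive n (w : {set 'I_d} -> F) :
  (forall S, #|S| != n -> w S = 0) -> (forall T, boundary (mulX F) w T = 0) ->
  (n = 0%N -> taylor (w finset.set0) mpoly.mnm0 = 0) ->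
  exists2 u : {set 'I_d} -> F, forall S, #|S| != n.+1 -> u S = 0 &
    forall S, boundary (mulX F) u S = w S.
Proof.
move=> wn wk w0.
pose b S : mnm -> C := fun a => (mpoly.mdeg a + n)%:R^-1 *: taylor (w S) a.
have /choice[y yE] : forall p : 'I_d * {set 'I_d}, exists y : F,
    taylor y = series_deriv p.1 (b p.2).
  move=> [j S]; have [y hy] := deriv_exists act_bounded (w S) j n.
  exists y; apply/funext => a; rewrite hy /series_deriv /b /= scalerA.
  by rewrite mpoly.mdegD mpoly.mdeg1 addn1.
have b0 S : #|S| != n -> b S = 0.
  by move=> Sn; apply/funext => a; rewrite /b wn // taylor0 scaler0.
pose u S := \sum_(j in S) ksign R[i] j S *: y (j, S :\ j)%SET.
have uE S : taylor (u S) = coboundary (@series_deriv R d C) b S.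
  by rewrite taylor_sum; apply: eq_bigr => j _; rewrite taylorZ yE.
exists u => S.
  move=> Sn; apply: taylor_inj; rewrite taylor0 uE; apply: big1 => j jS.
  rewrite b0 ?linear0 ?scaler0 //; apply: contraNneq Sn => <-.
  by rewrite [in X in X == _](cardsD1 j) jS.
apply: taylor_inj; rewrite taylor_boundary.
have -> : (fun S => taylor (u S)) = coboundary (@series_deriv R d C) b by apply/funext.
(* The boundary of [b] in degree [m] is that of [w] divided by [m + n - 1]: it
   raises the degree of the coefficients by one. *)
have bk T : boundary (@series_mulX R d C) b T = 0.
  apply/funext => a; rewrite /boundary sum_fctE.
  transitivity (((mpoly.mdeg a + n).-1%:R)^-1 *: taylor (boundary (mulX F) w T) a); last first.
    by rewrite wk taylor0 scaler0.
  rewrite taylor_boundary /boundary sum_fctE scaler_sumr; apply: eq_bigr => i iT.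
  rewrite -[LHS]/(ksign R[i] i T *: series_mulX i (b (i |: T)%SET) a).
  rewrite -[X in _ = _ *: X]/(ksign R[i] i T *: series_mulX i (taylor (w (i |: T)%SET)) a).
  rewrite scalerA mulrC -scalerA; congr (_ *: _); rewrite /series_mulX /b.
  have [a0|a0] := eqVneq (a i) 0%N; first by rewrite scaler0.
  congr (_%:R^-1 *: _).
  by rewrite -[in RHS](mnmBD a0) mpoly.mdegD mpoly.mdeg1 addn1.
have := boundary_euler (@series_deriv_mulX R d C) b S.
have -> : coboundary (@series_deriv R d C) (boundary (@series_mulX R d C) b) S = 0.
  by apply: big1 => j _; rewrite bk linear0 scaler0.
rewrite addr0 => ->; apply/funext => a.
rewrite -[LHS]/((\sum_i series_mulX i (series_deriv i (b S))) a + (b S *+ #|S|) a) sum_fctE.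
have -> : (b S *+ #|S|) a = #|S|%:R *: b S a by rewrite -scaler_nat.
under eq_bigr => i _ do rewrite series_mulX_deriv.
rewrite -scaler_suml -scalerDl -natr_sum -mpoly.mdegE -natrD.
have [Sn|Sn] := eqVneq #|S| n; last by rewrite b0 // wn // taylor0 scaler0.
rewrite /b scalerA Sn; have [a0|a0] := eqVneq (mpoly.mdeg a + n)%N 0%N.
  rewrite a0 mul0r scale0r; move/eqP: a0; rewrite addn_eq0 mpoly.mdeg_eq0 => /andP[/eqP -> /eqP n0].
  have -> : S = finset.set0 by apply/eqP; rewrite -cards_eq0 Sn n0.
  by rewrite w0.
by rewrite mulfV ?scale1r // pnatr_eq0.
Qed.
End Bounded.

(** The action on [F] bounds the action on [H2] unless [C] is zero, and then so
    is [F]. *)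
Lemma free_cases : (forall x, x = 0) \/ da_bounded H2.
Proof.
have [[c /eqP c0]|h] := pselect (exists c : C, c <> 0).
  by right; exact: (da_act_bounded F c0).
left; apply: free_eq0 => c; apply: contrapT => c0; apply: h; by exists c.
Qed.

Lemma koszul_exact k (w : koszul_space F k.+1) : koszul F k w = 0 ->
  exists u, koszul F k.+1 u = w.
Proof.
move=> w0; have [F0|bd] := free_cases.
  by exists 0; apply/ffunP => T; rewrite [LHS]F0 [RHS]F0.
have [|//|u un uw] := boundary_primitive bd (@extend_supp _ _ _ _ w).
  by move=> T; rewrite -extend_koszul w0 /extend; case: insub => // S; rewrite ffunE.
exists (form_of k.+2 u); apply: extend_inj => S.
by rewrite extend_koszul (eq_boundary (extend_form_of un)) uw.
Qed.

(** The identification of the 0-forms with [F]. *)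
Definition scalar_part (w : koszul_space F 0) : F := extend w finset.set0.

(** The homology in degree 0 is the space of values at the origin. *)
Lemma koszul_exact0 (w : koszul_space F 0) : value_at (scalar_part w) 0 = 0 ->
  exists u, koszul F 0 u = w.
Proof.
move=> w0; have [F0|bd] := free_cases.
  by exists 0; apply/ffunP => T; rewrite [LHS]F0 [RHS]F0.
have [|_|u un uw] := boundary_primitive bd (@extend_supp _ _ _ _ w).
- move=> T; apply: big1 => i iT; rewrite extend_supp ?linear0 ?scaler0 //.
  by rewrite cardsU1 iT.
- by rewrite (taylor_value0 bd).
exists (form_of 1 u); apply: extend_inj => S.
by rewrite extend_koszul (eq_boundary (extend_form_of un)) uw.
Qed.

Lemma value_koszul0 u : value_at (scalar_part (koszul F 0 u)) 0 = 0.
Proof.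
have [F0|bd] := free_cases.
  rewrite (F0 (scalar_part _)); apply: is_value_unique (value_atP _ _) _; exact: is_value0.
rewrite -(taylor_value0 bd) /scalar_part extend_koszul taylor_boundary // /boundary.
rewrite sum_fctE big1 // => i _.
rewrite -[LHS]/(ksign R[i] i finset.set0 *:
  series_mulX i (taylor (extend u (i |: finset.set0)%SET)) mpoly.mnm0).
by rewrite /series_mulX mpoly.mnm0E eqxx scaler0.
Qed.

End FreeKoszul.

(** * The diagram chase *)

Section Subquotients.
Variable K : nzRingType.

(** An isomorphism between the subquotients [ZU / BU] and [ZV / BV], given by a
    linear relation between representatives: unlike maps, the relations of a
    diagram chase compose without choices. *)
Definition subquot_iso (U V : lmodType K) (ZU BU : U -> Prop) (ZV BV : V -> Prop) : Prop :=
  exists rel : U -> V -> Prop,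
  [/\ forall k x x' y y', rel x y -> rel x' y' -> rel (k *: x + x') (k *: y + y'),
      forall x, ZU x -> exists2 y, ZV y & rel x y,
      forall y, ZV y -> exists2 x, ZU x & rel x y &
      forall x y, rel x y -> BU x <-> BV y].

Lemma subquot_iso_trans (U V W : lmodType K) (ZU BU : U -> Prop) (ZV BV : V -> Prop)
    (ZW BW : W -> Prop) :
  subquot_iso ZU BU ZV BV -> subquot_iso ZV BV ZW BW -> subquot_iso ZU BU ZW BW.
Proof.
move=> [r [rl rr rs rb]] [t [tl tr ts tb]].
exists (fun x z => exists2 y, r x y & t y z); split.
- move=> k x x' z z' [y ry ty] [y' ry' ty']; exists (k *: y + y'); [exact: rl|exact: tl].
- move=> x /rr[y /tr[z hz tz] ry]; exists z => //; by exists y.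
- move=> z /ts[y /rs[x hx rx] ty]; exists x => //; by exists y.
- by move=> x z [y /rb -> /tb ->].
Qed.

(** Choosing values of the induced relation between classes gives a linear map,
    because that relation is functional. *)
Lemma subquot_iso_homology (U V W U' V' W' : lmodType K)
    (f : {linear U -> V}) (g : {linear V -> W})
    (f' : {linear U' -> V'}) (g' : {linear V' -> W'}) :
  subquot_iso (fun x => g x = 0) (fun x => exists u, f u = x)
         (fun x => g' x = 0) (fun x => exists u, f' u = x) ->
  exists phi : {linear homology f g -> homology f' g'}, bijective phi.
Proof.
move=> [r [rl rr rs rb]].
have rB k x x' y y' : r x y -> r x' y' -> r (k *: (x - x')) (k *: (y - y')).
  move=> h h'; have h1 : r (x - x') (y - y').
    by have := rl (-1) _ _ _ _ h' h; rewrite !scaleN1r ![- _ + _]addrC.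
  have h0 : r 0 0 by have := rl (-1) _ _ _ _ h h; rewrite !scaleN1r !addNr.
  by have := rl k _ _ _ _ h1 h0; rewrite !addr0.
pose pr := @quot_proj _ _ (@im_pred _ _ _ _ f g).
pose pr' := @quot_proj _ _ (@im_pred _ _ _ _ f' g').
pose Q q q' := exists z z', [/\ pr z = q, pr' z' = q' & r (ker_val z) (ker_val z')].
have imP (z : ker_space g) : reflect (exists u, f u = ker_val z) (z \in @im_pred _ _ _ _ f g).
  by rewrite inE; apply: asboolP.
have imP' (z : ker_space g') : reflect (exists u, f' u = ker_val z) (z \in @im_pred _ _ _ _ f' g').
  by rewrite inE; apply: asboolP.
have Qf q a b : Q q a -> Q q b -> a = b.
  move=> [z [z' [zq <- rz]]] [w [w' [wq <- rw]]]; apply/quot_projP/imP'.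
  have : z - w \in @im_pred _ _ _ _ f g by apply/quot_projP; rewrite -/pr zq wq.
  move/imP; have := rB 1 _ _ _ _ rz rw; rewrite !scale1r => /rb.
  by move=> [h _] /h.
have Qi q p a : Q q a -> Q p a -> q = p.
  move=> [z [z' [<- zq rz]]] [w [w' [<- wq rw]]]; apply/quot_projP/imP.
  have : z' - w' \in @im_pred _ _ _ _ f' g' by apply/quot_projP; rewrite -/pr' zq wq.
  move/imP'; have := rB 1 _ _ _ _ rz rw; rewrite !scale1r => /rb.
  by move=> [_ h] /h.
have kerE (z : ker_space g) : g (ker_val z) = 0 by case: z => z /= /eqP.
have kerE' (z : ker_space g') : g' (ker_val z) = 0 by case: z => z /= /eqP.
have Qt q : exists a, Q q a.
  pose z := repr (q : Quotient.quot (sub_pred (@im_pred _ _ _ _ f g))).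
  have [y /eqP gy ry] := rr _ (kerE z).
  exists (pr' (KerSpace gy)), z, (KerSpace gy); split => //.
  exact: quot_proj_repr.
have Qs a : exists q, Q q a.
  pose z := repr (a : Quotient.quot (sub_pred (@im_pred _ _ _ _ f' g'))).
  have [y /eqP gy ry] := rs _ (kerE' z).
  exists (pr (KerSpace gy)), (KerSpace gy), z; split => //.
  exact: quot_proj_repr.
have /choice[phi phiQ] := Qt; have /choice[psi psiQ] := Qs.
have phil : linear phi.
  move=> k p q; apply: Qf (phiQ _) _.
  have [z [z' [zp zp' rz]]] := phiQ p; have [w [w' [wq wq' rw]]] := phiQ q.
  exists (k *: z + w), (k *: z' + w'); split.
  - by rewrite -zp -wq; exact: linearP.
  - by rewrite -zp' -wq'; exact: linearP.
  - exact: rl.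
pose phiL := HB.pack_for {linear homology f g -> homology f' g'} phi
  (GRing.isLinear.Build K _ _ *:%R phi phil).
exists phiL; exists psi => q.
  by apply: Qi (psiQ _) (phiQ q).
by apply: Qf (phiQ _) (psiQ q).
Qed.

End Subquotients.

Section Chase.
Variables (R : realType) (d : nat).

Section FormMap.
Variables (G H : hilbertModType R d) (f : {linear G -> H}).

Definition form_map k (w : koszul_space G k) : koszul_space H k := [ffun T => f (w T)].

Lemma form_map_linear k : linear (@form_map k).
Proof. by move=> a v w; apply/ffunP => T; rewrite !ffunE linearP. Qed.
HB.instance Definition _ k := GRing.isLinear.Build R[i] (koszul_space G k) (koszul_space H k)
  *:%R (@form_map k) (@form_map_linear k).

Lemma extend_form_map k (w : koszul_space G k) S : extend (form_map w) S = f (extend w S).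
Proof. by rewrite /extend; case: insub => [T|]; rewrite ?ffunE ?linear0. Qed.

Lemma koszul_form_map k (w : koszul_space G k.+1) : module_hom f ->
  koszul H k (form_map w) = form_map (koszul G k w).
Proof.
move=> fhom; apply: extend_inj => S; rewrite extend_form_map !extend_koszul linear_sum.
by apply: eq_bigr => i _; rewrite extend_form_map linearZ /= fhom.
Qed.

Lemma form_map_surj k (w : koszul_space H k) : range f = setT -> exists v, form_map v = w.
Proof.
move=> fs; have /choice[v hv] : forall T, exists x, f x = w T.
  by move=> T; have : [set: H] (w T) by []; rewrite -fs => -[x _ hx]; exists x.
by exists [ffun T => v T]; apply/ffunP => T; rewrite !ffunE.
Qed.

End FormMap.

Lemma form_map_exact (E G H : hilbertModType R d) (f : {linear E -> G}) (g : {linear G -> H}) k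
    (w : koszul_space G k) : [set x | g x = 0] = range f ->
  form_map g w = 0 <-> exists v, form_map f v = w.
Proof.
move=> ex; split=> [gw|[v <-]].
  have /choice[v hv] : forall T, exists x, f x = w T.
    move=> T; have : [set x | g x = 0] (w T).
      by have /ffunP/(_ T) := gw; rewrite !ffunE.
    by rewrite ex => -[x _ hx]; exists x.
  by exists [ffun T => v T]; apply/ffunP => T; rewrite !ffunE.
apply/ffunP => T; rewrite !ffunE.
have : [set x | g x = 0] (f (v T)) by rewrite ex; exists (v T).
by [].
Qed.

Section Values.
Variables (H2 : druryArveson R d).

Lemma value_linear (C : hilbertType R) (F : freeModule H2 C) k (x y : F) z :
  value_at (k *: x + y) z = k *: value_at x z + value_at y z.
Proof.
by apply: is_value_unique (value_atP _ _) _; apply: is_valueP; apply: value_atP.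
Qed.

Lemma value_tens1 (C : hilbertType R) (F : freeModule H2 C) c :
  value_at (tens F (da_one H2) c) 0 = c.
Proof.
apply: is_value_unique (value_atP _ _) _.
have := is_value_tens F (da_one H2) c 0.
rewrite -da_evalE; last exact: unit_ball0.
by rewrite da_oneE ?scale1r //; exact: unit_ball0.
Qed.

(** The inverse of [scalar_part]. *)
Definition const_form (G : hilbertModType R d) (x : G) : koszul_space G 0 := [ffun=> x].

Lemma scalar_part_const (C : hilbertType R) (F : freeModule H2 C) (x : F) :
  scalar_part (const_form x) = x.
Proof.
rewrite /scalar_part /extend; case: insubP => [T|]; first by rewrite ffunE.
by rewrite cards0 eqxx.
Qed.

Lemma scalar_part_linear (C : hilbertType R) (F : freeModule H2 C) k (v w : koszul_space F 0) :
  scalar_part (k *: v + w) = k *: scalar_part v + scalar_part w.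
Proof.
by rewrite /scalar_part /extend; case: insub => [T|]; rewrite ?ffunE // scaler0 addr0.
Qed.

Lemma value_scalar_part_linear (C : hilbertType R) (F : freeModule H2 C) k
    (v w : koszul_space F 0) :
  value_at (scalar_part (k *: v + w)) 0 =
  k *: value_at (scalar_part v) 0 + value_at (scalar_part w) 0.
Proof. by rewrite scalar_part_linear value_linear. Qed.

Lemma const_decomp (C : hilbertType R) (F : freeModule H2 C) (w w' : koszul_space F 0) :
  value_at (scalar_part w) 0 = value_at (scalar_part w') 0 -> exists u, w = w' + koszul F 0 u.
Proof.
move=> ww'; have [|u hu] := @koszul_exact0 _ _ _ _ F (w - w').
  by rewrite addrC -scaleN1r value_scalar_part_linear ww' scaleN1r addNr.
by exists u; rewrite hu addrC subrK.
Qed.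

(** The difference between a vector and the constant function with the same value
    at the origin is a combination of the [z_i], which module maps preserve. *)
Lemma localize_value (D C : hilbertType R) (F : freeModule H2 D) (G : freeModule H2 C)
    (Phi : {linear F -> G}) (w : koszul_space F 0) : module_hom Phi ->
  localize Phi 0 (value_at (scalar_part w) 0) = value_at (scalar_part (form_map Phi w)) 0.
Proof.
move=> hPhi; set c := value_at _ _.
have [|u ->] := @const_decomp _ F w (const_form (tens F (da_one H2) c)).
  by rewrite scalar_part_const value_tens1.
rewrite linearD /= -koszul_form_map // addrC -[X in X + _]scale1r value_scalar_part_linear.
rewrite value_koszul0 scaler0 add0r /scalar_part extend_form_map -/(scalar_part _).
by rewrite scalar_part_const.
Qed.

End Values.

Section DoubleComplex.
Variables (H2 : druryArveson R d) (H : hilbertModType R d).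
Variables (C : nat -> hilbertType R) (F : forall i : nat, freeModule H2 (C i)).
Variables (Phi0 : {linear F 0%N -> H}) (Phi : forall i : nat, {linear F i.+1 -> F i}).
Hypothesis rs : free_resolution Phi0 Phi.

(** The subquotients met along the diagonal: forms on the [p]-th free module whose
    boundary comes from the next module, modulo boundaries and forms that come
    from the next module.  A form [y] corresponds to a form [y'] on the next
    module, of degree one less, when the boundary of [y] is the image of [y']. *)
Definition diag_cycle p q (y : koszul_space (F p) q.+1) :=
  exists v, koszul (F p) q y = form_map (Phi p) v.
Definition diag_boundary p q (y : koszul_space (F p) q.+1) :=
  exists u v, y = koszul (F p) q.+1 u + form_map (Phi p) v.

(** The class of a cycle of [H] corresponds to the classes of its lifts to the
    first free module. *)
Lemma link_augmentation k :
  subquot_iso (fun x => koszul H k x = 0) (fun x => exists u, koszul H k.+1 u = x)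
         (@diag_cycle 0 k) (@diag_boundary 0 k).
Proof.
have hom0 := res_hom0 rs.
exists (fun x y => x = form_map Phi0 y); split.
- by move=> a x x' y y' -> ->; rewrite linearP.
- move=> x x0; have [y yx] := form_map_surj x (res_surj rs); exists y => //.
  have /(form_map_exact _ (res_exact0 rs))[v hv] : form_map Phi0 (koszul (F 0%N) k y) = 0.
    by rewrite -koszul_form_map // yx.
  by exists v.
- move=> y [v hv]; exists (form_map Phi0 y) => //; rewrite koszul_form_map // hv.
  by apply/(form_map_exact _ (res_exact0 rs)); exists v.
move=> x y ->; split=> [[u hu]|[u [v ->]]].
  have [v hv] := form_map_surj u (res_surj rs).
  have /(form_map_exact _ (res_exact0 rs))[v' hv'] : form_map Phi0 (y - koszul (F 0%N) k.+1 v) = 0.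
    by rewrite linearB /= -koszul_form_map // hv hu subrr.
  by exists v, v'; rewrite hv' addrC subrK.
exists (form_map Phi0 u); rewrite linearD /= koszul_form_map //.
have -> : form_map Phi0 (form_map (Phi 0%N) v) = 0.
  by apply/(form_map_exact _ (res_exact0 rs)); exists v.
by rewrite addr0.
Qed.

(** Exact rows show that [y'] is again a cycle of the diagonal, and exact columns
    provide [y] for a given [y']. *)
Lemma link_step p q :
  subquot_iso (@diag_cycle p q.+1) (@diag_boundary p q.+1)
    (@diag_cycle p.+1 q) (@diag_boundary p.+1 q).
Proof.
have hom := res_hom rs.
have ex k (w : koszul_space (F p.+1) k) := form_map_exact w (res_exact rs p).
exists (fun y y' => koszul (F p) q.+1 y = form_map (Phi p) y'); split.
- by move=> a x x' y y' hx hx'; rewrite !linearP /= hx hx'.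
- move=> y [v hv]; exists v => //.
  have /ex[v' hv'] : form_map (Phi p) (koszul (F p.+1) q v) = 0.
    by rewrite -koszul_form_map // -hv koszul_koszul.
  by exists v'.
- move=> y' [v hv].
  have [|y hy] := @koszul_exact _ _ _ _ _ _ (form_map (Phi p) y').
    by rewrite koszul_form_map // hv; apply/ex; exists v.
  by exists y => //; exists y'.
move=> y y' hyy'; split=> [[u [v yE]]|[u [v y'E]]].
  have /ex[v' hv'] : form_map (Phi p) (y' - koszul (F p.+1) q.+1 v) = 0.
    rewrite linearB /= -koszul_form_map // -hyy' yE linearD /= koszul_koszul add0r subrr //.
  by exists v, v'; rewrite hv' addrC subrK.
have [|w hw] := @koszul_exact _ _ _ _ _ _ (y - form_map (Phi p) u).
  rewrite linearB /= hyy' y'E koszul_form_map // linearD /=.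
  have -> : form_map (Phi p) (form_map (Phi p.+1) v) = 0 by apply/ex; exists v.
  by rewrite addr0 subrr.
by exists w, u; rewrite hw subrK.
Qed.

(** The last step of the diagonal: the 0-form [y'] is replaced by its value at the
    origin, which determines it modulo boundaries. *)
Lemma link_localization p :
  subquot_iso (@diag_cycle p 0) (@diag_boundary p 0) (fun c => localize (Phi p) 0 c = 0)
         (fun c => exists c', localize (Phi p.+1) 0 c' = c).
Proof.
have hom := res_hom rs.
have ex k (w : koszul_space (F p.+1) k) := form_map_exact w (res_exact rs p).
exists (fun y c => exists2 y', koszul (F p) 0 y = form_map (Phi p) y' &
  c = value_at (scalar_part y') 0).
split.
- move=> a x x' c c' [y hy ->] [y' hy' ->]; exists (a *: y + y').
    by rewrite !linearP /= hy hy'.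
  by rewrite value_scalar_part_linear.
- move=> y [v hv]; exists (value_at (scalar_part v) 0); last by exists v.
  by rewrite localize_value // -hv value_koszul0.
- move=> c hc; pose y' := const_form (tens (F p.+1) (da_one H2) c).
  have cE : c = value_at (scalar_part y') 0 by rewrite scalar_part_const value_tens1.
  have [|y hy] := @koszul_exact0 _ _ _ _ _ (form_map (Phi p) y').
    by rewrite -localize_value // -cE.
  by exists y; exists y'.
move=> y c [y' hyy' ->]; split=> [[u [v yE]]|[c' hc']].
  have /ex[v' hv'] : form_map (Phi p) (y' - koszul (F p.+1) 0 v) = 0.
    by rewrite linearB /= -koszul_form_map // -hyy' yE linearD /= koszul_koszul add0r subrr.
  exists (value_at (scalar_part v') 0); rewrite localize_value // hv'.
  by rewrite addrC -scaleN1r value_scalar_part_linear value_koszul0 scaler0 add0r.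
pose w := const_form (tens (F p.+2) (da_one H2) c').
have [|v y'E] := @const_decomp _ _ _ y' (form_map (Phi p.+1) w).
  by rewrite -localize_value // scalar_part_const value_tens1.
have [|u hu] := @koszul_exact _ _ _ _ _ _ (y - form_map (Phi p) v).
  rewrite linearB /= hyy' y'E koszul_form_map // linearD /=.
  have -> : form_map (Phi p) (form_map (Phi p.+1) w) = 0 by apply/ex; exists w.
  by rewrite add0r subrr.
by exists u, v; rewrite hu subrK.
Qed.

Lemma link_diagonal q p n : (p + q)%N = n ->
  subquot_iso (@diag_cycle p q) (@diag_boundary p q) (fun c => localize (Phi n) 0 c = 0)
         (fun c => exists c', localize (Phi n.+1) 0 c' = c).
Proof.
elim: q p => [|q IHq] p; first by rewrite addn0 => <-; exact: link_localization.
by rewrite addnS -addSn => /IHq; apply: subquot_iso_trans; exact: link_step.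
Qed.

End DoubleComplex.
End Chase.

(* The maps [koszul H k] and [Phi k] are the ones with index [k.+1]:
   [koszul H k] goes from E_{k+1} to E_k and [Phi k] from F_{k+1} to F_k.
   The isomorphism is thus the one in degree [k.+1]. *)
Theorem theorem2p9 (R : realType) (d : nat) (H2 : druryArveson R d)
    (H : hilbertModType R d) (Hcontr : contractive H) (Hpure : pure H2 H)
    (C : nat -> hilbertType R) (F : forall i : nat, freeModule H2 (C i))
    (Phi0 : {linear F 0%N -> H}) (Phi : forall i : nat, {linear F i.+1 -> F i})
    (res : free_resolution Phi0 Phi) (k : nat) :
  exists f : {linear homology (koszul H k.+1) (koszul H k)
                  -> homology (localize (Phi k.+1) 0) (localize (Phi k) 0)},
    bijective f.
Proof.
apply: subquot_iso_homology; apply: subquot_iso_trans (link_augmentation res k) _.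
exact: (link_diagonal res (add0n k)).
Qed.
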